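(* Let $m>1$ be an integer, let $(G_n)_{n\ge 2}$ be a sequence of random graphs following the linear de-preferential attachment model with parameter $m$, and let $i\ge 1$ be fixed. Then, as $n\to\infty$, $$\frac{d_i(n)-m\log n}{\sqrt{m\log n}}\longrightarrow N(0,1)\quad\text{in distribution.}$$
   Context: Linear de-preferential attachment model with parameter $m>1$: $G_n$ is a multigraph with vertices $v_1,\dots,v_n$, and $d_i(n)$ is the degree of $v_i$ in $G_n$ (all incident edges and half-edges counted, with multiplicity). The process starts from $G_2$, consisting of two vertices $v_1,v_2$ joined by $m$ edges together with $m$ extra ''free'' edges (half-edges) attached to one of the two vertices, which count toward that vertex's degree; thus the degrees in $G_2$ are $m$ and $2m$. Given $G_n$ ($n\ge2$), a new vertex $v_{n+1}$ with $m$ half-edges $e_{n+1,1},\dots,e_{n+1,m}$ is added, and these are attached one after the other to vertices among $v_1,\dots,v_n$. Let $d_j(n+1,k)$, $k=0,\dots,m-1$, be the degree of $v_j$, $1\le j\le n$, after $k$ of the half-edges of $v_{n+1}$ have been attached, with $d_j(n+1,0)=d_j(n)$, and let $\mathscr{F}_{n+1,k}$ be the natural filtration of the process at that stage. Then for $j=1,\dots,n$ and $k=0,\dots,m-1$, $$P(e_{n+1,k+1}=\{v_j,v_{n+1}\}\mid\mathscr{F}_{n+1,k})=\frac{1}{n-1}\left(1-\frac{d_j(n+1,k)}{k+(2n-1)m}\right).$$ Each attachment raises the degree of the chosen vertex by one; $d_j(n+1)$, $j\le n$, is the degree of $v_j$ after all $m$ half-edges have been attached, and $d_{n+1}(n+1)=m$.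 *)

(* Defs.v *)
From HB Require Import structures.
From mathcomp Require Import all_boot all_order all_algebra.
From mathcomp Require Import all_classical all_reals all_analysis.

Set Implicit Arguments.
Unset Strict Implicit.
Unset Printing Implicit Defensive.

Import Order.TTheory GRing.Theory Num.Theory.
Import numFieldNormedType.Exports.

Local Open Scope classical_set_scope.
Local Open Scope ring_scope.

(* The vertices are v_1, ..., v_n with n = nvertices, and v_j is represented by
   its index j. The edges are listed in their order of creation; a half-edge is
   represented by the vertex it hangs from. *)
Record multigraph := Multigraph {
  nvertices : nat;
  edges : seq (nat * nat);
  half_edges : seq nat }.

Definition degree (g : multigraph) (j : nat) : nat :=
  ((\sum_(e <- edges g) ((e.1 == j) + (e.2 == j))) + count_mem j (half_edges g))%N.

(* v_1 and v_2 joined by m edges, and m free half-edges attached to v_s. *)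
Definition initial_graph (m s : nat) : multigraph :=
  Multigraph 2 (nseq m (1, 2)%N) (nseq m s).

Definition add_vertex (m : nat) (g : multigraph) : multigraph :=
  Multigraph (nvertices g).+1 (edges g)
    (nseq m (nvertices g).+1 ++ half_edges g).

(* One pending half-edge of the newest vertex becomes an edge to v_j. The free
   half-edges of the initial graph hang from v_1 or v_2, so rem never removes
   one of them when the newest vertex is v_3 or later. *)
Definition attach (g : multigraph) (j : nat) : multigraph :=
  Multigraph (nvertices g) (rcons (edges g) (j, nvertices g))
    (rem (nvertices g) (half_edges g)).

(* p is (a version of) the conditional probability of E given the
   sigma-algebra F. *)
Definition is_cond_prob (d : measure_display) (T : measurableType d)
    (R : realType) (P : probability T R) (F : set (set T)) (E : set T)
    (p : T -> R) : Prop :=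
  (forall B : set R, measurable B -> F (p @^-1` B)) /\
  (forall A : set T, F A -> P (A `&` E) = (\int[P]_(w in A) (p w)%:E)%E).

(* The natural filtration at stage (n, k), for n >= 3: generated by G_2, by all
   the attachments made by v_3, ..., v_(n-1), and by the first k attachments
   made by v_n. Here e l r is the index of the vertex to which the r-th
   half-edge of v_l is attached, 1 <= r <= m. *)
Definition natural_filtration (T : Type) (m : nat) (G2 : T -> multigraph)
    (e : nat -> nat -> T -> nat) (n k : nat) : set (set T) :=
  <<s [set A | (exists g : multigraph, A = [set w | G2 w = g]) \/
       (exists l r j : nat,
          ((2 < l < n)%N /\ (1 <= r <= m)%N \/ l = n /\ (1 <= r <= k)%N) /\
          A = [set w | e l r w = j])] >>.

(* H n k is the graph after k of the m half-edges of v_n have been attached. *)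
Record depref_attachment_run (d : measure_display) (T : measurableType d)
    (R : realType) (P : probability T R) (m : nat) (G : nat -> T -> multigraph)
    (H : nat -> nat -> T -> multigraph) (e : nat -> nat -> T -> nat) : Prop := {
  run_measurable_init : forall g : multigraph, measurable [set w | G 2%N w = g];
  run_measurable_target : forall n k j : nat, (2 <= n)%N -> (k < m)%N ->
    measurable [set w | e n.+1 k.+1 w = j];
  run_init : forall w : T,
    G 2%N w = initial_graph m 1 \/ G 2%N w = initial_graph m 2;
  run_target : forall (n k : nat) (w : T), (2 <= n)%N -> (k < m)%N ->
    (1 <= e n.+1 k.+1 w <= n)%N;
  run_new_vertex : forall (n : nat) (w : T), (2 <= n)%N ->
    H n.+1 0%N w = add_vertex m (G n w);
  run_attach : forall (n k : nat) (w : T), (2 <= n)%N -> (k < m)%N ->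
    H n.+1 k.+1 w = attach (H n.+1 k w) (e n.+1 k.+1 w);
  run_complete : forall (n : nat) (w : T), (2 <= n)%N ->
    G n.+1 w = H n.+1 m w;
  run_cond_prob : forall n k j : nat,
    (2 <= n)%N -> (k < m)%N -> (1 <= j <= n)%N ->
    is_cond_prob P (natural_filtration m (G 2%N) e n.+1 k)
      [set w | e n.+1 k.+1 w = j]
      (fun w => 1 / (n%:R - 1) *
         (1 - (degree (H n.+1 k w) j)%:R / (k%:R + (2 * n%:R - 1) * m%:R))) }.

Definition linear_depref_attachment (d : measure_display)
    (T : measurableType d) (R : realType) (P : probability T R) (m : nat)
    (G : nat -> T -> multigraph) : Prop :=
  exists (H : nat -> nat -> T -> multigraph) (e : nat -> nat -> T -> nat),
    depref_attachment_run P m G H e.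

(* Only the tail of the sequence matters, so X n need be a random variable only
   for large n. *)
Definition cvg_in_distribution (d : measure_display) (T : measurableType d)
    (R : realType) (P : probability T R) (X : nat -> T -> R)
    (mu : probability (measurableTypeR R) R) : Prop :=
  (\forall n \near \oo, measurable_fun [set: T] (X n)) /\
  (forall x : R, {for x, continuous (fun y : R => mu [set` `]-oo, y]])} ->
     P [set w | X n w <= x] @[n --> \oo] --> mu [set` `]-oo, x]]).

(* Main.v *)
(* Write D for the degree of v_i along the attachment steps. It is a Markov chain
   on nat: when v_(n+1) attaches an edge, D grows by one with probability
   p = 1/(n-1) - O(D/n^2), and E D = O(sqrt n), so p differs in mean by
   O(n^(-3/2)) from q = ln (n+1) - ln n. Let Q(l, k) = P(Poisson(l) <= k) and let
   time advance by q at each of the m steps at stage n, so that it is m ln n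
   when stage n starts. As dQ(l, k)/dl = Q(l, k-1) - Q(l, k), each step changes
   the expectation of Q(m ln N - time, K - D) by O(n^(-3/2)), which is summable.
   So, up to an error O(M^(-1/2)), D at time N has the law of D at time M plus an
   independent Poisson variable with mean m ln N - m ln M.
   The central limit theorem for Poisson(l), l -> oo, follows from
   Q(l, k) = int_l^oo x^k e^(-x) / k! dx: with x = k + y sqrt k the integrand is a
   constant times (1 + y / sqrt k)^k e^(- y sqrt k), which tends to e^(- y^2 / 2)
   with an integrable majorant; the total mass 1 fixes the constant, so that
   Stirling's formula is not needed. *)
Require Import Defs.
From HB Require Import structures.
From mathcomp Require Import all_boot all_order all_algebra.
From mathcomp Require Import all_classical all_reals all_analysis.
From mathcomp Require Import measurable_realfun ring lra.

Import Order.TTheory GRing.Theory Num.Theory.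
Import numFieldNormedType.Exports.

Local Open Scope classical_set_scope.
Local Open Scope ring_scope.

Set Implicit Arguments.
Unset Strict Implicit.
Unset Printing Implicit Defensive.

(** * The function s - ln (1 + s) *)

(** [k * log_gap (y / sqrt k)] is minus the logarithm of the rescaled Gamma density at [y]; its
    quadratic behaviour at 0 produces the Gaussian. *)
Definition log_gap {R : realType} (s : R) : R := s - ln (1 + s).

Lemma nondecreasing_of_derive_ge0 {R : realType} (f df : R -> R) (a : R) :
  (forall s, a < s -> is_derive s 1 f (df s)) ->
  (forall s, a < s -> 0 <= df s) ->
  forall s t, a < s -> s <= t -> f s <= f t.
Proof.
move=> fdf df0 s t as_ st.
have dfx x : x \in `[s, t] -> is_derive x 1 f (df x).
  by rewrite in_itv/= => /andP[sx _]; exact/fdf/(lt_le_trans as_).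
have cf : {within `[s, t], continuous f}.
  apply: (@derivable_within_continuous R R f `[s, t]%R) => x xst.
  by have [] := dfx x xst.
have dfo x : x \in `]s, t[%R -> is_derive x 1 f (df x).
  by move=> xst; apply: dfx; exact: subset_itv_oo_cc xst.
have [c cst E] := @MVT_segment R f df s t st dfo cf.
rewrite -subr_ge0 E mulr_ge0 ?subr_ge0// df0//.
by move: cst; rewrite in_itv/= => /andP[sc _]; exact: lt_le_trans sc.
Qed.

Lemma is_derive_log_gap {R : realType} (s : R) : -1 < s ->
  is_derive s 1 log_gap (s / (1 + s)).
Proof.
move=> s1; have s0 : 0 < 1 + s by lra.
have h : is_derive s 1 (fun s : R => 1 + s) 1.
  by apply: is_derive_eq; rewrite add0r mulr1.
have hl : is_derive (1 + s) 1 (@ln R) (1 + s)^-1 by exact: is_derive1_ln.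
have h2 := @is_derive1_comp R (@ln R) (fun s : R => 1 + s) s _ _ hl h.
rewrite (_ : log_gap = id - ((@ln R) \o (fun s => 1 + s)))//.
by apply: is_derive_eq; rewrite mulr1; field; rewrite gt_eqF.
Qed.

(* Both differences from [log_gap] are increasing and vanish at 0. *)
Lemma log_gap_between {R : realType} (s : R) : -1 < s ->
  (0 <= s -> s ^+ 2 / (2 * (1 + s)) <= log_gap s <= s ^+ 2 / 2) /\
  (s <= 0 -> s ^+ 2 / 2 <= log_gap s <= s ^+ 2 / (2 * (1 + s))).
Proof.
move=> s1.
pose A (s : R) := s ^+ 2 / 2 - log_gap s.
pose B (s : R) := log_gap s - s ^+ 2 / (2 * (1 + s)).
have A0 : A 0 = 0 by rewrite /A /log_gap addr0 ln1; ring.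
have B0 : B 0 = 0 by rewrite /B /log_gap addr0 ln1; field.
have mA : forall s t, -1 < s -> s <= t -> A s <= A t.
  apply: (@nondecreasing_of_derive_ge0 R A (fun s : R => s ^+ 2 / (1 + s))).
    move=> t t1; have t0 : 1 + t != 0 by rewrite gt_eqF//; lra.
    have h := is_derive_log_gap t1; rewrite /A.
    by apply: is_derive_eq; rewrite /GRing.scale/=; field.
  by move=> t t1; rewrite divr_ge0 ?sqr_ge0//; lra.
have mB : forall s t, -1 < s -> s <= t -> B s <= B t.
  apply: (@nondecreasing_of_derive_ge0 R B (fun s : R => s ^+ 2 / (2 * (1 + s) ^+ 2))).
    move=> t t1; have t0 : 1 + t != 0 by rewrite gt_eqF//; lra.
    have h := is_derive_log_gap t1; rewrite /B.
    have t2 : 2 * (1 + t) != 0 by rewrite mulf_neq0.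
    by apply: is_derive_eq; rewrite /GRing.scale/=; field.
  by move=> t t1; rewrite divr_ge0 ?sqr_ge0// mulr_ge0// sqr_ge0.
split=> s0.
  have := mA 0 s (ltrN10 _) s0; have := mB 0 s (ltrN10 _) s0.
  by rewrite A0 B0 /A /B; lra.
have := mA s 0 s1 s0; have := mB s 0 s1 s0.
by rewrite A0 B0 /A /B; lra.
Qed.

(** * Poisson probabilities *)

(** The sharper bound for [s <= 0] is weakened so that one formula in [|s|] serves both signs. *)
Lemma log_gap_ge {R : realType} (s : R) : -1 < s ->
  s ^+ 2 / (2 * (1 + `|s|)) <= log_gap s.
Proof.
move=> s1; have [Hp Hn] := log_gap_between s1.
have [s0|s0] := lerP 0 s; first by rewrite ger0_norm//; have /andP[] := Hp s0.
have /andP[+ _] := Hn (ltW s0); apply: le_trans.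
by rewrite ler_wpM2l ?sqr_ge0// lef_pV2 ?posrE; have := normr_ge0 s; lra.
Qed.

Lemma log_gap_le {R : realType} (s : R) : `|s| < 1 ->
  log_gap s <= s ^+ 2 / (2 * (1 - `|s|)).
Proof.
move=> s1; have sN1 : -1 < s by move: s1; rewrite ltr_norml => /andP[].
have [Hp Hn] := log_gap_between sN1.
have [s0|s0] := lerP 0 s.
  have /andP[_] := Hp s0; move/le_trans; apply.
  move: s1; rewrite ger0_norm// => s1.
  by rewrite ler_wpM2l ?sqr_ge0// lef_pV2 ?posrE; have := normr_ge0 s; lra.
by rewrite ltr0_norm// opprK; have /andP[] := Hn (ltW s0).
Qed.

Section poisson_tail.
Context {R : realType}.
Implicit Types (l x y : R) (k : nat).

Definition pois l k : R := l ^+ k / k`!%:R * expR (- l).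

(* P(Poisson(l) < k), with a strict inequality. *)
Definition pois_cdf l k : R := \sum_(i < k) pois l i.

Lemma pois_ge0 l k : 0 <= l -> 0 <= pois l k.
Proof. by move=> l0; rewrite mulr_ge0 ?expR_ge0// divr_ge0 ?exprn_ge0. Qed.

Lemma pois_le1 l k : 0 <= l -> pois l k <= 1.
Proof.
move=> l0; rewrite /pois expRN ler_pdivrMr ?expR_gt0// mul1r.
case: k => [|k].
  by rewrite expr0 fact0 divr1 -expR0 ler_expR.
by apply: le_trans (expR_ge1Dxn k l0); rewrite lerDr.
Qed.

(** Since [pois l k * l = k.+1 * pois l k.+1] and a weight is at most 1. This gives the decay in [l]
    for fixed [k]. *)
Lemma pois_le_inv l k : 0 < l -> pois l k <= k.+1%:R / l.
Proof.
move=> l0; rewrite ler_pdivlMr//.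
have -> : pois l k * l = k.+1%:R * pois l k.+1.
  rewrite /pois factS natrM exprSr; field.
  by rewrite nat1r !pnatr_eq0 -lt0n fact_gt0.
by rewrite ler_piMr// pois_le1// ltW.
Qed.

Lemma pois_cdfS l k : pois_cdf l k.+1 = pois_cdf l k + pois l k.
Proof. by rewrite /pois_cdf big_ord_recr. Qed.

Lemma pois_cdf0 k : pois_cdf 0 k.+1 = 1.
Proof.
rewrite /pois_cdf big_ord_recl big1 => [|i _]; last by rewrite /pois expr0n/= !mul0r.
by rewrite /pois expr0 fact0 divr1 oppr0 expR0 mulr1 addr0.
Qed.

Lemma is_derive_pois0 l : is_derive l 1 (pois ^~ 0) (- pois l 0).
Proof.
rewrite /pois; under eq_fun do rewrite expr0 fact0 divr1 mul1r.
by apply: is_derive_eq; rewrite /GRing.scale/= expr0 fact0; field.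
Qed.

Lemma is_derive_poisS l k :
  is_derive l 1 (pois ^~ k.+1) (pois l k - pois l k.+1).
Proof.
have h : is_derive l 1 (fun x : R => x ^+ k.+1) (k.+1%:R * l ^+ k).
  by apply: DeriveDef; [exact: exprn_derivable|rewrite exp_derive /GRing.scale/= mulr1].
have h' : is_derive l 1 (fun x : R => expR (- x)) (- expR (- l)).
  by apply: is_derive_eq; rewrite mulrN1.
rewrite /pois; apply: is_derive_eq; rewrite /GRing.scale/= factS natrM exprS.
field.
by rewrite nat1r !pnatr_eq0 -lt0n fact_gt0.
Qed.

(** Each weight has as derivative a difference of two neighbouring weights, so the sum telescopes to
    its last one. *)
Lemma is_derive_pois_cdf l k :
  is_derive l 1 (pois_cdf ^~ k.+1) (- pois l k).
Proof.
elim: k => [|k IH].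
  have h := is_derive_pois0 l.
  by under eq_fun do rewrite pois_cdfS /pois_cdf big_ord0 add0r.
have h := is_derive_poisS l k.
under eq_fun do rewrite pois_cdfS.
by apply: is_derive_eq; ring.
Qed.

Lemma pois_cdf_cvg0 k : pois_cdf l k @[l --> +oo] --> (0 : R).
Proof.
elim: k => [|k IH].
  under eq_fun do rewrite /pois_cdf big_ord0.
  exact: cvg_cst.
under eq_fun do rewrite pois_cdfS.
rewrite -[0]addr0; apply: cvgD => //.
apply: (@squeeze_cvgr _ _ _ _ (fun=> 0) (fun l => k.+1%:R / l)).
- near=> l; rewrite pois_ge0//= pois_le_inv//; near: l; exact: nbhs_pinfty_gt.
- exact: cvg_cst.
- rewrite -(mulr0 k.+1%:R); apply: cvgMr.
  apply/(@gtr0_cvgV0 _ _ _ _ (fun l : R => l)); last exact: cvg_id.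
  exact: nbhs_pinfty_gt.
Unshelve. all: end_near. Qed.

End poisson_tail.

(** * Poisson tails as integrals *)

Section poisson_integral.
Context {R : realType}.
Implicit Types (x y a : R) (k : nat).
Notation mu := (@lebesgue_measure R).

(* The Gamma(k + 1) density at [k + y sqrt k], up to a constant factor. *)
Definition rescaled_gamma k y : R :=
  (1 + y / Num.sqrt k%:R) ^+ k * expR (- (Num.sqrt k%:R * y)).

Lemma sqrt_nat_gt0 k : (0 < k)%N -> 0 < Num.sqrt (k%:R : R).
Proof. by move=> k0; rewrite sqrtr_gt0 ltr0n. Qed.

Lemma pois_rescale k y : (0 < k)%N ->
  pois (k%:R + Num.sqrt k%:R * y) k = pois k%:R k * rescaled_gamma k y.
Proof.
move=> k0; have s0 := sqrt_nat_gt0 k0.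
rewrite /pois /rescaled_gamma opprD expRD.
have -> : k%:R + Num.sqrt k%:R * y = k%:R * (1 + y / Num.sqrt k%:R) :> R.
  rewrite -{1 3}(@sqr_sqrtr _ k%:R)//; field.
  by rewrite gt_eqF.
rewrite exprMn; ring.
Qed.

Lemma continuous_rescaled_gamma k : continuous (rescaled_gamma k).
Proof.
move=> y; rewrite /rescaled_gamma; apply: cvgM.
  apply: (@continuous_comp _ _ _ (fun y : R => 1 + y / Num.sqrt k%:R) (fun y => y ^+ k)).
    by apply: cvgD; [exact: cvg_cst|apply: cvgMl; exact: cvg_id].
  exact: exprn_continuous.
apply: (@continuous_comp _ _ _ (fun y : R => - (Num.sqrt k%:R * y)) expR).
  by apply: cvgN; apply: cvgMr; exact: cvg_id.
exact: continuous_expR.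
Qed.

(** After the substitution [x = k + y sqrt k], the integrand is the derivative of [F], which
    vanishes at infinity. The bound on [a] keeps the Poisson mean, and hence the integrand,
    nonnegative. *)
Lemma pois_cdf_integral k a : (0 < k)%N -> - Num.sqrt k%:R <= a ->
  (\int[mu]_(y in `[a, +oo[)
    (Num.sqrt k%:R * pois k%:R k * rescaled_gamma k y)%:E)%E =
  (pois_cdf (k%:R + Num.sqrt k%:R * a) k.+1)%:E.
Proof.
move=> k0 ka; have s0 := sqrt_nat_gt0 k0.
pose sh y : R := k%:R + Num.sqrt k%:R * y.
pose f y : R := Num.sqrt k%:R * pois k%:R k * rescaled_gamma k y.
pose F y : R := - pois_cdf (sh y) k.+1.
have dsh y : is_derive y 1 sh (Num.sqrt k%:R).
  by apply: is_derive_eq; rewrite /GRing.scale/=; ring.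
have dF y : is_derive y 1 F (f y).
  have h := is_derive_pois_cdf (sh y) k.
  have h2 := @is_derive1_comp R (pois_cdf ^~ k.+1) sh y _ _ h (dsh y).
  rewrite /F.
  have h3 : is_derive y 1 (- ((pois_cdf ^~ k.+1) \o sh)) (f y).
    by apply: is_derive_eq; rewrite /f /sh pois_rescale//; ring.
  exact: h3.
rewrite (@ge0_continuous_FTC2y R f F a 0).
- by rewrite sub0e /F EFinN oppeK.
- move=> y ay; rewrite /f -mulrA -pois_rescale//.
  rewrite mulr_ge0 ?sqrtr_ge0// pois_ge0//.
  have -> : k%:R + Num.sqrt k%:R * y = Num.sqrt k%:R * (Num.sqrt k%:R + y) :> R.
    by rewrite mulrDr -expr2 sqr_sqrtr.
  rewrite mulr_ge0 ?sqrtr_ge0//; lra.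
- apply: continuous_subspaceT => y; apply: cvgMr.
  exact: continuous_rescaled_gamma.
- rewrite -oppr0; apply: cvgN.
  apply: (@cvg_comp _ _ _ sh (pois_cdf ^~ k.+1) _ (pinfty_nbhs R)); last exact: pois_cdf_cvg0.
  apply: (@cvg_comp _ _ _ (fun y => Num.sqrt k%:R * y) (fun y => k%:R + y) _ (pinfty_nbhs R)).
    by apply: gt0_cvgMry => //; exact: cvg_id.
  exact: cvg_addrl.
- by move=> y _; have [] := dF y.
- apply: cvg_at_right_filter.
  by apply: differentiable_continuous; apply/derivable1_diffP; have [] := dF a.
- by move=> y _; rewrite derive1E; have [_ ->] := dF y.
Qed.
End poisson_integral.

(** * Pointwise Gaussian limit and exponential majorant of the rescaled Gamma densities *)

Section gamma_limit.
Context {R : realType}.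
Implicit Types (x y a : R) (k : nat).

Lemma rescaled_gammaE k y : (0 < k)%N -> - Num.sqrt k%:R < y ->
  rescaled_gamma k y = expR (- (k%:R * log_gap (y / Num.sqrt k%:R))).
Proof.
move=> k0 ky; have s0 := @sqrt_nat_gt0 R k k0.
have y1 : 0 < 1 + y / Num.sqrt k%:R.
  by rewrite -(ltr_pM2r s0) mul0r mulrDl mul1r mulfVK ?gt_eqF//; lra.
rewrite /rescaled_gamma /log_gap mulrBr opprB expRD expRM_natl lnK//.
congr (_ * expR (- _)).
rewrite -{2}(@sqr_sqrtr _ k%:R)//; field.
by rewrite gt_eqF.
Qed.

Lemma rescaled_gamma_ge0 k y : (0 < k)%N -> - Num.sqrt k%:R <= y ->
  0 <= rescaled_gamma k y.
Proof.
(* At the left endpoint the base of the power is 0, so [rescaled_gammaE] does not apply; the power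
   vanishes because [k] is positive. *)
move=> k0; rewrite le_eqVlt => /predU1P[<-|ky]; last by rewrite rescaled_gammaE// expR_ge0.
rewrite /rescaled_gamma mulNr divff ?subrr ?expr0n ?gtn_eqF ?mul0r//.
by rewrite gt_eqF// sqrt_nat_gt0.
Qed.

(** A majorant free of [k]: by [log_gap_ge] minus the exponent is at least
    [y^2 / (2 (1 + |y| / sqrt k))], and [sqrt k >= 1]. *)
Lemma rescaled_gamma_le k y : (0 < k)%N -> - Num.sqrt k%:R <= y ->
  rescaled_gamma k y <= expR ((1 - `|y|) / 2).
Proof.
move=> k0; have s0 := @sqrt_nat_gt0 R k k0.
rewrite le_eqVlt => /predU1P[<-|ky].
  rewrite /rescaled_gamma mulNr divff ?subrr ?expr0n ?gtn_eqF ?mul0r ?expR_ge0//.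
  by rewrite gt_eqF.
rewrite rescaled_gammaE// ler_expR.
have y1 : -1 < y / Num.sqrt k%:R by rewrite ltr_pdivlMr// mulN1r.
have := log_gap_ge y1; rewrite normrM normfV (gtr0_norm s0).
rewrite -(ler_pM2l (_ : 0 < k%:R)) ?ltr0n//.
have -> : k%:R * ((y / Num.sqrt k%:R) ^+ 2 / (2 * (1 + `|y| / Num.sqrt k%:R))) =
    y ^+ 2 / (2 * (1 + `|y| / Num.sqrt k%:R)).
  rewrite -{1}(@sqr_sqrtr _ k%:R)//; field.
  rewrite gt_eqF//= gt_eqF//; have := normr_ge0 y; lra.
have h : y ^+ 2 / (2 * (1 + `|y|)) <= y ^+ 2 / (2 * (1 + `|y| / Num.sqrt k%:R)).
  have yk : `|y| / Num.sqrt k%:R <= `|y|.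
    by rewrite ler_piMr// invf_le1// -[leLHS]sqrtr1 ler_wsqrtr// ler1n.
  rewrite ler_wpM2l ?sqr_ge0// lef_pV2 ?posrE.
  - by rewrite ler_pM2l//; lra.
  - by have := normr_ge0 y; lra.
  - by have : 0 <= `|y| / Num.sqrt k%:R by rewrite divr_ge0// ltW; lra.
(* With the denominator cleared this is [(|y| - 1) (|y| + 1) <= y^2]. *)
have : (`|y| - 1) / 2 <= y ^+ 2 / (2 * (1 + `|y|)).
  have := normr_ge0 y; rewrite -(real_normK (num_real y)); set z := `|y| => z0.
  rewrite ler_pdivlMr; last lra.
  nra.
lra.
Qed.

Lemma cvgy_sqrt {T : Type} (F : set_system T) {FF : Filter F} (f : T -> R) :
  f t @[t --> F] --> +oo -> Num.sqrt (f t) @[t --> F] --> +oo.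
Proof.
move=> fy; apply/cvgryPge => A; near=> t.
rewrite (le_trans (ler_norm A))// -sqrtr_sqr ler_wsqrtr//.
by near: t; exact: cvgry_ge.
Unshelve. all: end_near. Qed.

(** With [s = |y| / sqrt k], minus the exponent lies between [y^2 / (2 (1 + s))] and
    [y^2 / (2 (1 - s))], and [s] tends to 0. *)
Lemma cvg_rescaled_gamma (k_ : nat -> nat) y : (k_ n)%:R @[n --> \oo] --> (+oo : set_system R) ->
  rescaled_gamma (k_ n) y @[n --> \oo] --> expR (- (y ^+ 2 / 2)).
Proof.
move=> koo.
have kpos : \forall n \near \oo, (0 < k_ n)%N.
  near=> n; rewrite -(ltr0n R); near: n; move/cvgryPgt : koo; exact.
pose s n : R := `|y| / Num.sqrt (k_ n)%:R.
have s0 : s n @[n --> \oo] --> (0 : R).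
  rewrite -(mulr0 `|y|); apply: cvgMr.
  apply/(gtr0_cvgV0 (f := fun n => Num.sqrt (k_ n)%:R)); last exact: cvgy_sqrt.
  near=> n; apply: sqrt_nat_gt0; near: n; exact: kpos.
pose u n : R := y ^+ 2 / (2 * (1 + s n)).
pose v n : R := y ^+ 2 / (2 * (1 - s n)).
have cu : u n @[n --> \oo] --> y ^+ 2 / 2.
  rewrite -[X in _ / X]mulr1 -[X in _ / (_ * X)](addr0 1); apply: cvgMr; apply: cvgV.
    by rewrite addr0 mulr1.
  by apply: cvgMr; apply: cvgD => //; exact: cvg_cst.
have cv : v n @[n --> \oo] --> y ^+ 2 / 2.
  rewrite -[X in _ / X]mulr1 -[X in _ / (_ * X)](subr0 1); apply: cvgMr; apply: cvgV.
    by rewrite subr0 mulr1.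
  by apply: cvgMr; apply: cvgB => //; exact: cvg_cst.
have : (k_ n)%:R * log_gap (y / Num.sqrt (k_ n)%:R) @[n --> \oo] --> y ^+ 2 / 2.
  apply: (squeeze_cvgr _ cu cv).
  near=> n.
  have k0 : (0 < k_ n)%N by near: n.
  have sq0 := @sqrt_nat_gt0 R _ k0.
  have s1 : `|y / Num.sqrt (k_ n)%:R| < 1.
    rewrite normrM normfV (gtr0_norm sq0) -/(s n).
    by near: n; exact: (cvgr_lt _ s0).
  have s2 : -1 < y / Num.sqrt (k_ n)%:R by move: s1; rewrite ltr_norml => /andP[].
  have kp : 0 < (k_ n)%:R :> R by rewrite ltr0n.
  have E : (y / Num.sqrt (k_ n)%:R) ^+ 2 = y ^+ 2 / (k_ n)%:R.
    by rewrite expr_div_n sqr_sqrtr.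
  have := log_gap_le s1; have := log_gap_ge s2.
  rewrite normrM normfV (gtr0_norm sq0) -/(s n) E; set z := _ / (k_ n)%:R => h1 h2.
  have yz : y ^+ 2 = (k_ n)%:R * z by rewrite mulrC divfK// gt_eqF.
  by clearbody z; rewrite /u /v yz -!mulrA !ler_pM2l// h1 h2.
move=> /cvgN h.
apply: cvg_trans (continuous_cvg _ (@continuous_expR _ _) h).
apply: near_eq_cvg; near=> n => /=.
rewrite rescaled_gammaE//; first by near: n.
rewrite ltrNl; apply: lt_le_trans (_ : `|y| + 1 <= _).
  by have := ler_norm (- y); rewrite normrN; lra.
by near: n; apply: cvgry_ge; exact: cvgy_sqrt.
Unshelve. all: end_near. Qed.

End gamma_limit.

(** * Dominated convergence for integrals of the rescaled Gamma densities *)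

Section gamma_integral_limit.
Context {R : realType}.
Implicit Types (x y a : R) (k : nat).
Notation mu := (@lebesgue_measure R).

Let continuous_exp_decay : continuous (fun y : R => expR ((1 - `|y|) / 2)).
Proof.
move=> y; apply: (@continuous_comp _ _ _ (fun y : R => (1 - `|y|) / 2) expR).
  apply: cvgMl; apply: cvgB; first exact: cvg_cst.
  exact: norm_continuous.
exact: continuous_expR.
Qed.

(** By evenness it is enough to integrate over the half-line, where [-2 * f] is an
    antiderivative. *)
Lemma integrable_exp_decay :
  mu.-integrable [set: R] (fun y : R => (expR ((1 - `|y|) / 2))%:E).
Proof.
apply/integrableP; split.
  by apply/measurable_EFinP; exact: continuous_measurable_fun.
under eq_integral do rewrite /= ger0_norm ?expR_ge0//.
rewrite ge0_symfun_integralT//; last first.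
  by move=> y /=; rewrite normrN.
rewrite lte_mul_pinfty// (_ : [set x | _] = `[0, +oo[%classic); last first.
  by apply/seteqP; split => x/=; rewrite in_itv/= andbT.
pose f y : R := expR ((1 - y) / 2).
pose F y : R := - 2 * f y.
have -> : (\int[mu]_(y in `[0%R, +oo[) (expR ((1 - `|y|) / 2))%:E =
    \int[mu]_(y in `[0%R, +oo[) (f y)%:E)%E.
  by apply: eq_integral => y; rewrite inE/= in_itv/= andbT => y0; rewrite ger0_norm.
have dF y : is_derive y 1 F (f y).
  by rewrite /F /f; apply: is_derive_eq; rewrite /GRing.scale/=; field.
have cf : continuous f.
  move=> y; apply: (@continuous_comp _ _ _ (fun y : R => (1 - y) / 2) expR).
    by apply: cvgMl; apply: cvgB; [exact: cvg_cst|exact: cvg_id].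
  exact: continuous_expR.
rewrite (@ge0_continuous_FTC2y R f F 0 0) ?ltry//.
- by move=> y _; exact: expR_ge0.
- exact: continuous_subspaceT.
- rewrite -(mulr0 (- 2)); apply: cvgMr.
  rewrite (_ : f = (fun y : R => expR (- y)) \o (fun y : R => (y + -1) / 2)); last first.
    by apply/funext => y; rewrite /f/=; congr expR; field.
  have h : (fun y : R => (y + -1) / 2) @ pinfty_nbhs R --> pinfty_nbhs R.
    by apply: gt0_cvgMly; [rewrite invr_gt0|exact: cvg_addrr].
  exact: (cvg_comp _ _ h (@cvgr_expR R)).
- apply: cvg_at_right_filter.
  by apply: differentiable_continuous; apply/derivable1_diffP; have [] := dF 0.
- by move=> y _; rewrite derive1E; have [_ ->] := dF y.
Qed.

(** Dominated convergence with a moving endpoint: the indicators of [[a_ n, +oo[] converge to that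
    of [B] off the single point [b]. A general [B] covers both a half-line and the whole line. *)
Lemma cvg_integral_rescaled_gamma (k_ : nat -> nat) (a_ : nat -> R) (b : R) (B : set R) :
  measurable B -> (forall n, (0 < k_ n)%N) ->
  (forall n, - Num.sqrt (k_ n)%:R <= a_ n) ->
  (k_ n)%:R @[n --> \oo] --> (+oo : set_system R) ->
  (forall y, y != b -> \forall n \near \oo, (a_ n <= y) = (y \in B)) ->
  (\int[mu]_(y in `[a_ n, +oo[) (rescaled_gamma (k_ n) y)%:E)%E @[n --> \oo] -->
  (\int[mu]_(y in B) (expR (- (y ^+ 2 / 2)))%:E)%E.
Proof.
move=> mB k0 ka koo aB.
pose f_ n := (fun y : R => (rescaled_gamma (k_ n) y)%:E) \_ `[a_ n, +oo[.
pose f := (fun y : R => (expR (- (y ^+ 2 / 2)))%:E) \_ B.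
have mpatch (g : R -> R) (D : set R) : measurable D -> continuous g ->
    measurable_fun [set: R] ((fun y => (g y)%:E) \_ D).
  move=> mD cg; apply/(measurable_restrictT (fun y => (g y)%:E) mD).
  by apply/measurable_EFinP/measurable_funTS; exact: continuous_measurable_fun.
have mf n : measurable_fun [set: R] (f_ n).
  by apply: mpatch => //; exact: continuous_rescaled_gamma.
have mg : measurable_fun [set: R] f.
  apply: mpatch => // y; apply: (@continuous_comp _ _ _ (fun y : R => - (y ^+ 2 / 2)) expR).
    by apply: cvgN; apply: cvgMl; exact: exprn_continuous.
  exact: continuous_expR.
have [] := @dominated_convergence _ _ R mu setT measurableT f_ f _ mf mg _ integrable_exp_decay _.
- exists [set b]; split; [exact: measurable_set1|exact: lebesgue_measure_set1|].
  move=> y /= ny; apply: contrapT => /eqP yb; apply: ny => _.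
  have := aB y yb.
  have [yB|yB] := boolP (y \in B) => near_ay.
    rewrite /f patchE yB.
    have h : (rescaled_gamma (k_ n) y)%:E @[n --> \oo] --> (expR (- (y ^+ 2 / 2)))%:E.
      by apply/fine_cvgP; split; [exact: nearW|exact: cvg_rescaled_gamma].
    apply: cvg_trans h.
    apply: near_eq_cvg; near=> n.
    rewrite /f_ patchE ifT// inE/= in_itv/= andbT.
    by near: n.
  rewrite /f patchE (negbTE yB).
  apply: cvg_near_cst; near=> n.
  rewrite /f_ patchE ifF//; apply/negbTE; rewrite notin_setE/= in_itv/= andbT.
  by apply/negP/negbT; near: n.
- apply: aeW => y n _; rewrite /f_ patchE; case: ifPn => [|_].
    rewrite inE/= in_itv/= andbT => ay; rewrite lee_fin.
    have ky := le_trans (ka n) ay.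
    by rewrite ger0_norm ?rescaled_gamma_ge0// rescaled_gamma_le.
  by rewrite abse0 lee_fin expR_ge0.
move=> _ _; rewrite /f -integral_mkcond; apply: cvg_trans; apply: near_eq_cvg.
by apply: nearW => n; rewrite integral_mkcond.
Unshelve. all: end_near. Qed.

End gamma_integral_limit.

(** * The central limit theorem for Poisson laws *)

Section poisson_clt.
Context {R : realType}.
Implicit Types (x y a : R) (k : nat).
Notation mu := (@lebesgue_measure R).
Let gauss y : R := expR (- (y ^+ 2 / 2)).

Let normal_pdf01E y : normal_pdf 0 1 y = normal_peak 1 * gauss y.
Proof.
rewrite normal_pdfE ?oner_neq0// /normal_fun /gauss subr0 expr1n; congr (_ * expR _).
by rewrite mulNr.
Qed.

Let continuous_gauss : continuous gauss.
Proof.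
move=> y; apply: (@continuous_comp _ _ _ (fun y : R => - (y ^+ 2 / 2)) expR).
  by apply: cvgN; apply: cvgMl; exact: exprn_continuous.
exact: continuous_expR.
Qed.

Let measurable_gauss (D : set R) : measurable D -> measurable_fun D (fun y => (gauss y)%:E).
Proof.
by move=> mD; apply/measurable_EFinP/measurable_funTS; exact: continuous_measurable_fun.
Qed.

Let integral_peak_gauss (D : set R) : measurable D ->
  (\int[mu]_(y in D) (normal_pdf 0 1 y)%:E =
   (normal_peak 1)%:E * \int[mu]_(y in D) (gauss y)%:E)%E.
Proof.
move=> mD; rewrite -ge0_integralZl//=.
- by apply: eq_integral => y _; rewrite normal_pdf01E EFinM.
- exact: measurable_gauss.
- by move=> y _; rewrite lee_fin expR_ge0.
- by rewrite lee_fin normal_peak_ge0.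
Qed.

(** Read off from the total mass 1 of the normal density. *)
Let integral_gauss : (\int[mu]_y (gauss y)%:E)%E = ((normal_peak 1)^-1)%:E.
Proof.
have p0 : (normal_peak 1 : R) != 0 by rewrite gt_eqF// normal_peak_gt0// oner_neq0.
have := integral_peak_gauss measurableT; rewrite integral_normal_pdf => h.
have -> : (normal_peak 1)^-1%:E = ((normal_peak 1)^-1%:E * 1 : \bar R)%E by rewrite mule1.
by rewrite h muleA -EFinM mulVf// mul1e.
Qed.

(** The reflection [y -> - y] is required because a lower Poisson tail is an upper Gamma tail. *)
Let normal_prob_tail x :
  normal_prob 0 1 [set` `]-oo, x]] =
  ((normal_peak 1)%:E * \int[mu]_(y in `[(- x)%R, +oo[) (gauss y)%:E)%E.
Proof.
rewrite -integral_peak_gauss// /normal_prob.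
rewrite -{1}(opprK x) ge0_integration_by_substitutionNy.
- by apply: eq_integral => y _; rewrite /= !normal_pdf01E /gauss sqrrN.
- by apply: continuous_subspaceT; apply: continuous_normal_pdf; exact: oner_neq0.
- by move=> y _; exact: normal_pdf_ge0.
Qed.

(** The Poisson distribution function is [c n] times the Gamma integral from [a_ n], the endpoint
    that corresponds to the mean [l_ n]. The integral converges by domination, and the limit of
    [c n] comes from the same identity on the full range. *)
Lemma pois_cdf_clt_pos (k_ : nat -> nat) (l_ : nat -> R) x :
  (forall n, (0 < k_ n)%N) -> (forall n, 0 <= l_ n) ->
  (k_ n)%:R @[n --> \oo] --> (+oo : set_system R) ->
  ((k_ n)%:R - l_ n) / Num.sqrt (k_ n)%:R @[n --> \oo] --> x ->
  pois_cdf (l_ n) (k_ n).+1 @[n --> \oo] --> fine (normal_prob 0 1 [set` `]-oo, x]]).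
Proof.
move=> k0 l0 koo kx.
have s0 n := @sqrt_nat_gt0 R _ (k0 n).
pose a_ n : R := (l_ n - (k_ n)%:R) / Num.sqrt (k_ n)%:R.
have ax : a_ n @[n --> \oo] --> - x.
  under eq_fun do rewrite /a_ -opprB mulNr.
  exact: cvgN.
have ka n : - Num.sqrt (k_ n)%:R <= a_ n.
  by rewrite /a_ ler_pdivlMr// mulNr -expr2 sqr_sqrtr// lerBrDr addNr.
have cJ : (\int[mu]_(y in `[a_ n, +oo[) (rescaled_gamma (k_ n) y)%:E)%E @[n --> \oo] -->
    (\int[mu]_(y in `[(- x)%R, +oo[) (gauss y)%:E)%E.
  apply: (@cvg_integral_rescaled_gamma _ _ _ (- x)) => // y yx.
  have [xy|xy|xy] := ltgtP y (- x); last by rewrite xy eqxx in yx.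
    near=> n; rewrite [RHS]memNset; last by rewrite /= in_itv/= andbT; apply/negP; rewrite -ltNge.
    by apply/negbTE; rewrite -ltNge; near: n; exact: (cvgr_gt _ ax).
  near=> n; rewrite [RHS]mem_set; last by rewrite /= in_itv/= andbT ltW.
  by rewrite ltW//; near: n; exact: (cvgr_lt _ ax).
have cI : (\int[mu]_(y in `[(- Num.sqrt (k_ n)%:R)%R, +oo[) (rescaled_gamma (k_ n) y)%:E)%E
    @[n --> \oo] --> ((normal_peak 1)^-1)%:E.
  rewrite -integral_gauss.
  apply: (@cvg_integral_rescaled_gamma _ _ _ 0) => // y _.
  near=> n; rewrite in_setT.
  rewrite lerNl; near: n; apply: cvgry_ge; exact: cvgy_sqrt.
pose c n : R := Num.sqrt (k_ n)%:R * pois (k_ n)%:R (k_ n).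
have c0 n : 0 < c n.
  by rewrite /c mulr_gt0// /pois mulr_gt0 ?expR_gt0// divr_gt0 ?exprn_gt0 ?ltr0n ?fact_gt0.
have I_E n a : - Num.sqrt (k_ n)%:R <= a ->
    (\int[mu]_(y in `[a, +oo[) (rescaled_gamma (k_ n) y)%:E)%E =
    (pois_cdf ((k_ n)%:R + Num.sqrt (k_ n)%:R * a) (k_ n).+1 / c n)%:E.
  move=> kna; rewrite mulrC EFinM -pois_cdf_integral//.
  under [X in (_ * X)%E]eq_integral do rewrite EFinM.
  rewrite ge0_integralZl//=; last 3 first.
  - apply/measurable_EFinP/measurable_funTS.
    by apply: continuous_measurable_fun; exact: continuous_rescaled_gamma.
  - move=> y; rewrite in_itv/= andbT => ay; rewrite lee_fin rescaled_gamma_ge0//.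
    exact: le_trans ay.
  - by rewrite lee_fin ltW// c0.
  by rewrite muleA -EFinM mulVf ?mul1e// gt_eqF// c0.
have Jfin : (\int[mu]_(y in `[(- x)%R, +oo[) (gauss y)%:E)%E \is a fin_num.
  rewrite ge0_fin_numE; last by apply: integral_ge0 => y _; rewrite lee_fin expR_ge0.
  apply: (@le_lt_trans _ _ (\int[mu]_y (gauss y)%:E)%E); last by rewrite integral_gauss ltry.
  apply: ge0_subset_integral => //; first exact: measurable_gauss.
  by move=> y _; rewrite lee_fin expR_ge0.
(* At the endpoint [- sqrt k] the Poisson mean is 0 and the distribution function is 1, so the full
   integral is exactly [(c n)^-1]. *)
have cI' : (c n)^-1 @[n --> \oo] --> (normal_peak 1)^-1.
  have /fine_cvgP[_]// : ((c n)^-1)%:E @[n --> \oo] --> ((normal_peak 1)^-1)%:E.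
  apply: cvg_trans cI; apply: near_eq_cvg; apply: nearW => n.
  by rewrite I_E// mulrN -expr2 sqr_sqrtr// subrr pois_cdf0 div1r.
have cJ' : pois_cdf (l_ n) (k_ n).+1 / c n @[n --> \oo] -->
    fine (\int[mu]_(y in `[(- x)%R, +oo[) (gauss y)%:E)%E.
  have /fine_cvgP[_]// : (pois_cdf (l_ n) (k_ n).+1 / c n)%:E @[n --> \oo] -->
      (fine (\int[mu]_(y in `[(- x)%R, +oo[) (gauss y)%:E)%E)%:E.
  rewrite fineK//.
  apply: cvg_trans cJ; apply: near_eq_cvg; apply: nearW => n.
  by rewrite I_E// /a_ [Num.sqrt _ * _]mulrC divfK ?gt_eqF// addrC subrK.
have p0 : 0 < normal_peak 1 :> R by rewrite normal_peak_gt0// oner_neq0.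
rewrite normal_prob_tail fineM//= mulrC -[X in _ * X]invrK.
have -> : (fun n => pois_cdf (l_ n) (k_ n).+1) =
    (fun n => pois_cdf (l_ n) (k_ n).+1 / c n * ((c n)^-1)^-1).
  by apply/funext => n; rewrite invrK divfK// gt_eqF.
by apply: cvgM cJ' _; apply: cvgV => //; rewrite gt_eqF// invr_gt0.
Unshelve. all: end_near. Qed.

Lemma pois_cdf_clt (k_ : nat -> nat) (l_ : nat -> R) x :
  (\forall n \near \oo, 0 <= l_ n) ->
  (k_ n)%:R @[n --> \oo] --> (+oo : set_system R) ->
  ((k_ n)%:R - l_ n) / Num.sqrt (k_ n)%:R @[n --> \oo] --> x ->
  pois_cdf (l_ n) (k_ n).+1 @[n --> \oo] --> fine (normal_prob 0 1 [set` `]-oo, x]]).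
Proof.
move=> l0 koo kx.
pose k' n := maxn 1 (k_ n); pose l' n := Num.max 0 (l_ n).
have kE : \forall n \near \oo, k_ n = k' n.
  near=> n; apply/esym/maxn_idPr; rewrite -(ltr0n R).
  by near: n; move/cvgryPgt : koo; exact.
have lE : \forall n \near \oo, l_ n = l' n.
  by near=> n; apply/esym/max_idPr; near: n.
have := @pois_cdf_clt_pos k' l' x.
have h1 : (k' n)%:R @[n --> \oo] --> (+oo : set_system R).
  apply: cvg_trans koo; apply: near_eq_cvg; near=> n.
  by rewrite (near kE n)//.
have h2 : ((k' n)%:R - l' n) / Num.sqrt (k' n)%:R @[n --> \oo] --> x.
  apply: cvg_trans kx; apply: near_eq_cvg; near=> n.
  by rewrite (near kE n)// (near lE n).
have k'0 n : (0 < k' n)%N by rewrite /k' leq_max.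
have l'0 n : 0 <= l' n by rewrite /l' le_max lexx.
move=> /(_ k'0 l'0 h1 h2) h.
apply: cvg_trans h; apply: near_eq_cvg; near=> n.
by rewrite (near kE n)// (near lE n).
Unshelve. all: end_near. Qed.

End poisson_clt.

(** * Dependence of Poisson probabilities on the mean and on the threshold *)

Section poisson_step.
Context {R : realType}.
Implicit Types (l q : R) (k : nat).

(** The derivative in the mean is a difference of two numbers in [[0, 1]], up to the boundary case
    [k = 0], so it is at most 1 in absolute value. *)
Lemma pois_lipschitz l c k : 0 <= l -> l <= c -> `|pois c k - pois l k| <= c - l.
Proof.
move=> l0 lc.
pose dp y : R := if k is k'.+1 then pois y k' - pois y k'.+1 else - pois y 0.
have dpE (y : R) : is_derive y 1 (pois ^~ k) (dp y).
  by case: (k) @dp => [|k']; [exact: is_derive_pois0|exact: is_derive_poisS].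
have [y yin ->] : exists2 y, y \in `[l, c] & pois c k - pois l k = dp y * (c - l).
  apply: (@MVT_segment R (pois ^~ k)) => //.
  by apply: derivable_within_continuous => y _; have [] := dpE y.
have cl0 : 0 <= c - l by rewrite subr_ge0.
rewrite normrM (ger0_norm cl0) ler_piMl//.
have y0 : 0 <= y by move: yin; rewrite in_itv/= => /andP[ly _]; exact: le_trans ly.
rewrite ler_norml /dp; case: (k) => [|k'].
  by have := pois_ge0 0 y0; have := pois_le1 0 y0; lra.
have := pois_ge0 k' y0; have := pois_le1 k' y0.
by have := pois_ge0 k'.+1 y0; have := pois_le1 k'.+1 y0; lra.
Qed.

(** A single jump with probability [q] imitates Poisson time [q] up to [q ^+ 2]: the mean value
    theorem writes the increment as [- q * pois c k] at a nearby mean [c], and [pois_lipschitz]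
    moves [c] back to [l]. For threshold 0 all the sums are empty. *)
Lemma pois_cdf_step l q k : 0 <= l -> 0 <= q ->
  `|pois_cdf l k - q * (pois_cdf l k - pois_cdf l k.-1) - pois_cdf (l + q) k| <= q ^+ 2.
Proof.
move=> l0 q0; case: k => [|k] /=.
  by rewrite /pois_cdf !big_ord0 !subr0 mulr0 subr0 normr0 sqr_ge0.
have lq : l <= l + q by rewrite lerDl.
have [c cin E] : exists2 c, c \in `[l, l + q] &
    pois_cdf (l + q) k.+1 - pois_cdf l k.+1 = - pois c k * (l + q - l).
  apply: (@MVT_segment R (pois_cdf ^~ k.+1) (fun c => - pois c k)) => //.
    by move=> y _; exact: is_derive_pois_cdf.
  apply: derivable_within_continuous => y _.
  by have [] := is_derive_pois_cdf y k.
move: cin; rewrite in_itv/= => /andP[lc clq].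
have -> : pois_cdf l k.+1 - q * (pois_cdf l k.+1 - pois_cdf l k) - pois_cdf (l + q) k.+1 =
    q * (pois c k - pois l k).
  have -> : pois_cdf (l + q) k.+1 = pois_cdf l k.+1 - pois c k * q.
    by apply/eqP; rewrite -subr_eq0; apply/eqP; lra.
  by rewrite pois_cdfS; ring.
rewrite normrM ger0_norm// expr2 ler_wpM2l//.
by apply: le_trans (pois_lipschitz k l0 lc) _; lra.
Qed.

Lemma pois_cdf_homo l : 0 <= l -> {homo pois_cdf l : k k' / (k <= k')%N >-> k <= k'}.
Proof.
move=> l0 k k' /subnK <-; elim: (k' - k)%N => // d IH.
by rewrite addSn pois_cdfS (le_trans IH)// lerDl pois_ge0.
Qed.

Lemma pois_cdf_drop l k : 0 <= l -> 0 <= pois_cdf l k - pois_cdf l k.-1 <= 1.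
Proof.
move=> l0; case: k => [|k] /=; first by rewrite subrr lexx ler01.
by rewrite pois_cdfS addrAC subrr add0r pois_ge0// pois_le1.
Qed.

End poisson_step.

(** * Poisson limits at the threshold [m ln N + x sqrt (m ln N)] *)

Section pois_threshold.
Context {R : realType}.

Lemma cvgy_ln_nat : ln (n%:R : R) @[n --> \oo] --> +oo.
Proof.
apply/cvgryPge => A; near=> n.
rewrite -(expRK A) ler_ln ?posrE ?expR_gt0//.
  by near: n; apply: cvgry_ge; exact: cvgr_idn.
by near: n; move/cvgryPgt : (@cvgr_idn R); exact.
Unshelve. all: end_near. Qed.

Lemma cvgy_mln_nat (m : nat) : (0 < m)%N ->
  m%:R * ln (n%:R : R) @[n --> \oo] --> +oo.
Proof.
move=> m0.
apply: (@cvg_comp _ _ _ (fun n => ln n%:R) (fun y => m%:R * y) _ (pinfty_nbhs R)).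
  exact: cvgy_ln_nat.
by apply: gt0_cvgMry; [rewrite ltr0n|exact: cvg_id].
Qed.

(** With [r = sqrt (m ln n)] the threshold is [(r + x) * r], which is at least [r] once
    [r + x >= 1]. *)
Lemma near_threshold_ge (m : nat) (x : R) : (0 < m)%N ->
  \forall n \near \oo, 0 < Num.sqrt (m%:R * ln (n%:R : R)) <=
    m%:R * ln n%:R + x * Num.sqrt (m%:R * ln n%:R).
Proof.
move=> m0; have lamy := cvgy_mln_nat m0.
have ry : Num.sqrt (m%:R * ln (n%:R : R)) @[n --> \oo] --> +oo by exact: cvgy_sqrt.
have rgt0 : \forall n \near \oo, 0 < Num.sqrt (m%:R * ln (n%:R : R)).
  by move/cvgryPgt : ry; exact.
near=> n.
have l0 : 0 <= m%:R * ln (n%:R : R) by near: n; exact: cvgry_ge.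
have r0 : 0 < Num.sqrt (m%:R * ln (n%:R : R)) by near: n.
rewrite r0 -{2}(sqr_sqrtr l0) expr2 -mulrDl ler_peMl ?(ltW r0)//.
rewrite -lerBlDr; near: n; exact: cvgry_ge.
Unshelve. all: end_near. Qed.

(** The fixed starting stage [M] and the fixed shift [c] move mean and threshold by bounded amounts
    only, which disappear after division by [sqrt (m ln N)]. *)
Lemma cvg_pois_threshold (m M c : nat) (x : R) : (0 < m)%N ->
  pois_cdf (m%:R * (ln N%:R - ln M%:R))
    ((Num.truncn (m%:R * ln N%:R + x * Num.sqrt (m%:R * ln N%:R))).+1 - c)
    @[N --> \oo] --> fine (normal_prob 0 1 [set` `]-oo, x]]).
Proof.
move=> m0.
pose lam (N : nat) : R := m%:R * ln N%:R.
pose r N : R := Num.sqrt (lam N).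
pose v N : R := lam N + x * r N.
pose k N : nat := (Num.truncn (v N) - c)%N.
pose l N : R := m%:R * (ln N%:R - ln M%:R).
have lamy : lam N @[N --> \oo] --> +oo by exact: cvgy_mln_nat.
have ry : r N @[N --> \oo] --> +oo by exact: cvgy_sqrt.
have r0 : \forall N \near \oo, 0 < r N by move/cvgryPgt : ry; exact.
have lam0 : \forall N \near \oo, 0 < lam N by move/cvgryPgt : lamy; exact.
have rV : (r N)^-1 @[N --> \oo] --> (0 : R) by apply/gtr0_cvgV0.
have lamV : (lam N)^-1 @[N --> \oo] --> (0 : R) by apply/gtr0_cvgV0.
have rr : \forall N \near \oo, r N * r N = lam N.
  by near=> N; rewrite -expr2 sqr_sqrtr// ltW//; near: N.
have vr : \forall N \near \oo, r N <= v N.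
  by apply: filterS (near_threshold_ge x m0) => N /andP[].
have vc : \forall N \near \oo, c%:R <= v N.
  near=> N; have rv : r N <= v N by near: N.
  by apply: le_trans rv; near: N; exact: cvgry_ge.
have kv : \forall N \near \oo, v N - 1 - c%:R <= (k N)%:R <= v N - c%:R.
  near=> N.
  have cv : c%:R <= v N by near: N.
  have v0 : 0 <= v N by exact: le_trans cv.
  have /andP[h1 h2] := truncn_itv v0.
  rewrite /k natrB ?truncn_ge_nat//.
  by move: h2; rewrite -natr1; lra.
have ky : (k N)%:R @[N --> \oo] --> (+oo : set_system R).
  apply: (ger_cvgy (f := fun N => r N + (- 1 - c%:R))).
    near=> N.
    have rv : r N <= v N by near: N.
    have /andP[+ _] : v N - 1 - c%:R <= (k N)%:R <= v N - c%:R by near: N.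
    by apply: le_trans; rewrite -addrA lerD2r.
  apply: (@cvg_comp _ _ _ r (fun y => y + (- 1 - c%:R)) _ (pinfty_nbhs R)) => //.
  exact: cvg_addrr.
(* The total discrepancy: 1 from truncation, [c] from the shift, [m ln M] from the starting
   stage. *)
pose b : R := 1 + c%:R + `|m%:R * ln M%:R|.
have br : b * (r N)^-1 @[N --> \oo] --> (0 : R).
  by rewrite -(mulr0 b); exact: cvgMr.
have kl : ((k N)%:R - l N) / r N @[N --> \oo] --> x.
  apply: (@squeeze_cvgr _ _ _ _ (fun N => x - b * (r N)^-1) (fun N => x + b * (r N)^-1)).
  - near=> N.
    have rN0 : 0 < r N by near: N.
    have /andP[h1 h2] : v N - 1 - c%:R <= (k N)%:R <= v N - c%:R by near: N.
    have E1 : (x - b / r N) * r N = x * r N - b by field; rewrite gt_eqF.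
    have E2 : (x + b / r N) * r N = x * r N + b by field; rewrite gt_eqF.
    rewrite ler_pdivlMr// ler_pdivrMr// E1 E2.
    move: h1 h2; rewrite /v /l /b mulrBr -/(lam N).
    have := ler_norm (m%:R * ln M%:R :> R); have := ler_norm (- (m%:R * ln M%:R) :> R).
    rewrite normrN; have : 0 <= c%:R :> R by [].
    by set L := m%:R * ln M%:R; set xr := x * r N; lra.
  - by rewrite -[X in _ --> X]subr0; apply: cvgB => //; exact: cvg_cst.
  - by rewrite -[X in _ --> X]addr0; apply: cvgD => //; exact: cvg_cst.
have klam : (k N)%:R / lam N @[N --> \oo] --> (1 : R).
  have h : 1 - (m%:R * ln M%:R) * (lam N)^-1 + ((k N)%:R - l N) / r N * (r N)^-1
      @[N --> \oo] --> 1 - m%:R * ln M%:R * 0 + x * 0.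
    apply: cvgD; last exact: cvgM.
    by apply: cvgB; [exact: cvg_cst|exact: cvgMr].
  rewrite !mulr0 subr0 addr0 in h; apply: cvg_trans h; apply: near_eq_cvg; near=> N.
  have rN0 : 0 < r N by near: N.
  have lN0 : 0 < lam N by near: N.
  rewrite -[_ / r N / r N]mulrA -invfM (near rr N)// /l mulrBr -/(lam N).
  by field; rewrite gt_eqF.
(* Passes from the scale [sqrt (m ln N)] to the scale [sqrt k] used in [pois_cdf_clt]. *)
have sk : Num.sqrt (k N)%:R / r N @[N --> \oo] --> (1 : R).
  have h : Num.sqrt ((k N)%:R / lam N) @[N --> \oo] --> Num.sqrt (1 : R).
    by apply: continuous_cvg => //; exact: sqrt_continuous.
  rewrite sqrtr1 in h; apply: cvg_trans h; apply: near_eq_cvg; near=> N.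
  have lN0 : 0 < lam N by near: N.
  by rewrite sqrtrM// sqrtrV// ltW.
have kls : ((k N)%:R - l N) / Num.sqrt (k N)%:R @[N --> \oo] --> x.
  have h : ((k N)%:R - l N) / r N * (Num.sqrt (k N)%:R / r N)^-1 @[N --> \oo] --> x * 1^-1.
    by apply: cvgM => //; apply: cvgV => //; exact: oner_neq0.
  rewrite invr1 mulr1 in h; apply: cvg_trans h; apply: near_eq_cvg; near=> N.
  have rN0 : 0 < r N by near: N.
  rewrite invf_div mulrA divfK// gt_eqF//.
have l0 : \forall N \near \oo, 0 <= l N.
  near=> N; rewrite /l mulr_ge0// subr_ge0.
  by near: N; apply: cvgry_ge; exact: cvgy_ln_nat.
apply: cvg_trans (pois_cdf_clt l0 ky kls); apply: near_eq_cvg; near=> N.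
congr (pois_cdf _ _); rewrite /k subSn// truncn_ge_nat//.
  by near: N.
by apply: (@le_trans _ _ c%:R) => //; near: N.
Unshelve. all: end_near. Qed.

End pois_threshold.

(** * Comparison of the degree chain with a Poisson process *)

Definition depref_prob {R : realType} (m n k j : nat) : R :=
  1 / (n%:R - 1) * (1 - j%:R / (k%:R + (2 * n%:R - 1) * m%:R)).

(** Both bounds are [ln (1 + x) <= x], at [x = 1 / n] and at [x = - 1 / (n + 1)]. *)
Lemma ln_succ_bounds {R : realType} (n : nat) : (0 < n)%N ->
  n.+1%:R^-1 <= ln (n.+1%:R : R) - ln n%:R <= n%:R^-1.
Proof.
move=> n0; have n0R : 0 < n%:R :> R by rewrite ltr0n.
have n1R : 0 < n.+1%:R :> R by rewrite ltr0n.
have n1E : n.+1%:R = n%:R + 1 :> R by rewrite natr1.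
have pinv : 0 < n%:R^-1 :> R by rewrite invr_gt0.
rewrite -ln_div ?posrE//; apply/andP; split; last first.
  have -> : n.+1%:R / n%:R = 1 + n%:R^-1 :> R by rewrite n1E; field; rewrite gt_eqF.
  by apply: le_ln1Dx; lra.
have -> : n.+1%:R / n%:R = (n%:R / n.+1%:R)^-1 :> R by rewrite invf_div.
rewrite lnV ?posrE ?divr_gt0// lerNr.
have -> : n%:R / n.+1%:R = 1 + - n.+1%:R^-1 :> R.
  by rewrite n1E; field; rewrite -n1E gt_eqF.
by apply: le_ln1Dx; rewrite ltrN2 invf_lt1// ltr1n.
Qed.

(* [pmf n k j] stands for the probability that the degree is [j] after [k] of the
   half-edges of v_(n+1) have been attached; [B n] bounds the degree at stage [n]. *)
Section depref_chain.
Context {R : realType}.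
Variables (m n0 : nat) (pmf : nat -> nat -> nat -> R) (B : nat -> nat).
Notation p := (@depref_prob R m).
Hypothesis m_gt0 : (0 < m)%N.
Hypothesis n0_ge2 : (2 <= n0)%N.
Hypothesis pmf_ge0 : forall n k j, 0 <= pmf n k j.
Hypothesis pmf_supp : forall n k j,
  (n0 <= n)%N -> (k <= m)%N -> (B n <= j)%N -> pmf n k j = 0.
Hypothesis pmf_sum : forall n k,
  (n0 <= n)%N -> (k <= m)%N -> \sum_(j < B n) pmf n k j = 1.
Hypothesis pmf_step0 : forall n k, (n0 <= n)%N -> (k < m)%N ->
  pmf n k.+1 0 = pmf n k 0 * (1 - p n k 0).
Hypothesis pmf_stepS : forall n k j, (n0 <= n)%N -> (k < m)%N ->
  pmf n k.+1 j.+1 = pmf n k j.+1 * (1 - p n k j.+1) + pmf n k j * p n k j.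
Hypothesis pmf_next : forall n j, (n0 <= n)%N -> pmf n.+1 0 j = pmf n m j.

Definition chain_mean n k (f : nat -> R) : R := \sum_(j < B n) pmf n k j * f j.
Notation E := chain_mean.

(** Lengthening the range adds only zeros; this lets sums with different bounds [B n] be
    compared. *)
Let E_widen n k (f : nat -> R) L : (n0 <= n)%N -> (k <= m)%N -> (B n <= L)%N ->
  \sum_(j < L) pmf n k j * f j = E n k f.
Proof.
move=> nn km BL; rewrite /E (big_ord_widen L (fun j => pmf n k j * f j) BL).
rewrite [LHS](bigID (fun j : 'I_L => (j < B n)%N))/= [X in _ + X]big1 ?addr0//.
by move=> j; rewrite -leqNgt => Bj; rewrite pmf_supp// mul0r.
Qed.

Let E_next n (f : nat -> R) : (n0 <= n)%N -> E n.+1 0 f = E n m f.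
Proof.
move=> nn; rewrite -(@E_widen n.+1 0 f (maxn (B n) (B n.+1))) ?leq_maxr//; last exact: leqW.
rewrite -(@E_widen n m f (maxn (B n) (B n.+1))) ?leq_maxl//.
by apply: eq_bigr => j _; rewrite pmf_next.
Qed.

Let E_step n k (f : nat -> R) : (n0 <= n)%N -> (k < m)%N ->
  E n k.+1 f = E n k (fun j => (1 - p n k j) * f j + p n k j * f j.+1).
Proof.
move=> nn km.
(* Cutting the sum at [L] leaves one boundary term, the mass that jumps from [L] to [L.+1]; it is
   zero for [L = B n]. *)
have H L : \sum_(j < L.+1) pmf n k.+1 j * f j =
    \sum_(j < L.+1) pmf n k j * ((1 - p n k j) * f j + p n k j * f j.+1)
    - pmf n k L * p n k L * f L.+1.
  elim: L => [|L IH]; first by rewrite !big_ord_recr !big_ord0/= pmf_step0//; ring.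
  by rewrite big_ord_recr/= IH [in RHS]big_ord_recr/= pmf_stepS//; ring.
rewrite -(E_widen _ nn km (leqnSn _)) H -(E_widen _ nn (ltnW km) (leqnSn _)).
by rewrite (pmf_supp nn (ltnW km) (leqnn _)) !mul0r subr0.
Qed.

Let E_le n k (f g : nat -> R) : (forall j, f j <= g j) -> E n k f <= E n k g.
Proof. by move=> fg; apply: ler_sum => j _; rewrite ler_wpM2l. Qed.

Let E_affine n k (a b : R) : (n0 <= n)%N -> (k <= m)%N ->
  E n k (fun j => a + b * j%:R) = a + b * E n k (fun j => j%:R).
Proof.
move=> nn km; rewrite /E mulr_sumr -[X in X + _]mulr1 -(pmf_sum nn km) mulr_sumr -big_split/=.
by apply: eq_bigr => j _; ring.
Qed.

Let nR n : (n0 <= n)%N -> 2 <= n%:R :> R.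
Proof. by move=> nn; rewrite ler_nat (leq_trans n0_ge2). Qed.

Let denom_gt0 n k : (n0 <= n)%N -> 0 < k%:R + (2 * n%:R - 1) * m%:R :> R.
Proof.
move=> nn; have h := nR nn; rewrite ltr_wpDl// mulr_gt0 ?ltr0n//; lra.
Qed.

Let p_le n k j : (n0 <= n)%N -> p n k j <= (n%:R - 1)^-1.
Proof.
move=> nn; have h := nR nn; have d0 := denom_gt0 k nn.
rewrite /depref_prob div1r ler_piMr// ?invr_ge0; first by lra.
by rewrite gerBl divr_ge0// ltW.
Qed.

Let mean_step n k : (n0 <= n)%N -> (k < m)%N ->
  E n k.+1 (fun j => j%:R) <= E n k (fun j => j%:R) + (n%:R - 1)^-1.
Proof.
move=> nn km; rewrite E_step//.
apply: (@le_trans _ _ (E n k (fun j => (n%:R - 1)^-1 + 1 * j%:R))).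
  apply: E_le => j; have := p_le k j nn; rewrite -[j.+1%:R]natr1.
  have -> : (1 - p n k j) * j%:R + p n k j * (j%:R + 1) = p n k j + 1 * j%:R by ring.
  by rewrite lerD2r.
by rewrite E_affine//; [rewrite mul1r addrC|exact: ltnW].
Qed.

Let mean_steps n k : (n0 <= n)%N -> (k <= m)%N ->
  E n k (fun j => j%:R) <= E n 0 (fun j => j%:R) + k%:R * (n%:R - 1)^-1.
Proof.
move=> nn; elim: k => [|k IH] km; first by rewrite mul0r addr0.
apply: le_trans (mean_step nn km) _.
by rewrite -[k.+1%:R]natr1 mulrDl mul1r addrA lerD2r IH// ltnW.
Qed.

(** The first summand dominates the mean at stage [n0]; the second makes [C * sqrt n] outgrow the
    mean in each later stage. *)
Let C : R := (B n0)%:R + 6 * m%:R.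

(** The increment of the square root is [1 / (s + t) >= 1 / (2 (n + 1))], and
    [2 (n + 1) <= 6 (n - 1)] for [n >= 2], whence the 6 in [C]. *)
Let sqrt_incr n : (n0 <= n)%N ->
  C * Num.sqrt n%:R + m%:R / (n%:R - 1) <= C * Num.sqrt n.+1%:R.
Proof.
move=> nn; have h := nR nn.
rewrite -[n.+1%:R]natr1.
have s2 : Num.sqrt n%:R ^+ 2 = n%:R :> R by rewrite sqr_sqrtr//; lra.
have t2 : Num.sqrt (n%:R + 1) ^+ 2 = n%:R + 1 :> R by rewrite sqr_sqrtr//; lra.
have s0 : 0 <= Num.sqrt n%:R :> R by exact: sqrtr_ge0.
have t0 : 0 <= Num.sqrt (n%:R + 1) :> R by exact: sqrtr_ge0.
move: s2 t2 s0 t0; set s := Num.sqrt _; set t := Num.sqrt _ => s2 t2 s0 t0.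
have st : s <= t by rewrite ler_wsqrtr// lerDl.
have m0 : 0 <= m%:R :> R by [].
have t1 : t <= n%:R + 1.
  by rewrite -t2 expr2 ler_peMr// -[leLHS]sqrtr1 ler_wsqrtr//; lra.
rewrite -lerBrDl -mulrBr.
have CE : 6 * m%:R <= C by rewrite lerDr.
apply: (@le_trans _ _ (6 * m%:R * (t - s))); last by rewrite ler_wpM2r// subr_ge0.
rewrite ler_pdivrMr; last lra.
have -> : 6 * m%:R * (t - s) * (n%:R - 1) = m%:R * (6 * (t - s) * (n%:R - 1)) by ring.
rewrite -{1}[m%:R]mulr1 ler_wpM2l//.
have d : (t - s) * (t + s) = 1 by rewrite -subr_sqr s2 t2; ring.
have d2 : (t - s) * (t + s) <= (t - s) * (2 * (n%:R + 1)).
  by apply: ler_wpM2l; lra.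
have : (t - s) * (2 * (n%:R + 1)) <= (t - s) * (6 * (n%:R - 1)).
  apply: ler_wpM2l; lra.
lra.
Qed.

Let mean_bound n : (n0 <= n)%N -> E n 0 (fun j => j%:R) <= C * Num.sqrt n%:R.
Proof.
move=> /subnK <-; elim: (n - n0)%N => [|d IH].
  rewrite add0n; apply: (@le_trans _ _ (B n0)%:R).
    have -> : (B n0)%:R = \sum_(j < B n0) (B n0)%:R * pmf n0 0 j.
      by rewrite -mulr_sumr pmf_sum// mulr1.
    by apply: ler_sum => j _; rewrite mulrC ler_wpM2r// ler_nat ltnW.
  apply: (@le_trans _ _ (C * 1)); first by rewrite mulr1 lerDl mulr_ge0.
  rewrite ler_wpM2l ?addr_ge0 ?mulr_ge0// -[leLHS]sqrtr1 ler_wsqrtr//.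
  by have := nR (leqnn n0); lra.
rewrite addSn; have nn : (n0 <= d + n0)%N by rewrite leq_addl.
rewrite E_next//; apply: le_trans (sqrt_incr nn).
by apply: le_trans (mean_steps nn (leqnn m)) _; rewrite lerD2r.
Qed.

Let mean_bound_step n k : (n0 <= n)%N -> (k <= m)%N ->
  E n k (fun j => j%:R) <= C * Num.sqrt n.+1%:R.
Proof.
move=> nn km; apply: le_trans (sqrt_incr nn).
apply: le_trans (mean_steps nn km) _; apply: lerD; first exact: mean_bound.
by rewrite ler_wpM2r ?ler_nat// invr_ge0; have := nR nn; lra.
Qed.

Let q n : R := ln n.+1%:R - ln n%:R.

Let q_bounds n : (n0 <= n)%N -> (n%:R + 1)^-1 <= q n <= n%:R^-1.
Proof.
move=> nn; rewrite natr1; apply: ln_succ_bounds.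
by apply: leq_trans nn; exact: ltnW.
Qed.

(** The gap [1 / (n - 1) - q n] is nonnegative because [q n <= 1 / n], and the denominator under the
    degree is at least [n]. *)
Let p_close n k j : (n0 <= n)%N ->
  `|p n k j - q n| <= (n%:R - 1)^-1 - q n + ((n%:R - 1) * n%:R)^-1 * j%:R.
Proof.
move=> nn; have h := nR nn; have d0 := denom_gt0 k nn.
have /andP[q1 q2] := q_bounds nn.
have qn : q n <= (n%:R - 1)^-1.
  by apply: (le_trans q2); rewrite lef_pV2 ?posrE; lra.
have -> : p n k j - q n = (n%:R - 1)^-1 - q n -
    (n%:R - 1)^-1 * (j%:R / (k%:R + (2 * n%:R - 1) * m%:R)).
  by rewrite /depref_prob; ring.
apply: (le_trans (ler_normB _ _)); rewrite ger0_norm ?subr_ge0// lerD2l.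
have i0 : 0 <= (n%:R - 1)^-1 :> R by rewrite invr_ge0; lra.
rewrite ger0_norm; last by rewrite mulr_ge0// divr_ge0// ltW.
rewrite invfM -mulrA ler_wpM2l// mulrC ler_wpM2r// lef_pV2 ?posrE//; last lra.
have m1 : 1 <= m%:R :> R by rewrite ler1n.
have k0 : 0 <= k%:R :> R by [].
nra.
Qed.

(** * Test functions up to a fixed horizon [N] and their accumulated error *)

Section horizon.
Variables (N K : nat).

(* The Poisson time left, from step [k] of stage [n] until stage [N]. *)
Let tau n k : R := m%:R * (ln N%:R - ln n%:R) - k%:R * q n.

(** The probability that [j] plus a Poisson variable of mean [tau n k] is at most [K]. Truncated
    subtraction gives the right value 0 for [j > K]. *)
Let test_fun n k j : R := pois_cdf (tau n k) (K.+1 - j).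

Let tau_next n : tau n.+1 0 = tau n m.
Proof. by rewrite /tau /q; ring. Qed.

Let tau_step n k : tau n k = tau n k.+1 + q n.
Proof. by rewrite /tau -natr1; ring. Qed.

Let q_ge0 n : (n0 <= n)%N -> 0 <= q n.
Proof.
move=> nn; have /andP[+ _] := q_bounds nn; apply: le_trans.
by rewrite invr_ge0; have := nR nn; lra.
Qed.

Let tau_ge0 n k : (n0 <= n < N)%N -> (k <= m)%N -> 0 <= tau n k.
Proof.
move=> /andP[nn nN] km; rewrite /tau subr_ge0.
apply: (@le_trans _ _ (m%:R * q n)); first by rewrite ler_wpM2r ?q_ge0// ler_nat.
rewrite ler_wpM2l// /q lerD2r ler_ln ?posrE ?ltr0n ?ler_nat//.
exact: leq_trans nN.
Qed.

(** A jump of the degree lowers the remaining threshold by one, so the error splits into [(q - p)]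
    times a drop in [[0, 1]], controlled by [p_close], and the error of [pois_cdf_step]. *)
Let one_step_error n k j : (n0 <= n < N)%N -> (k < m)%N ->
  `|(1 - p n k j) * test_fun n k.+1 j + p n k j * test_fun n k.+1 j.+1
    - test_fun n k j| <=
  (n%:R - 1)^-1 - q n + q n ^+ 2 + ((n%:R - 1) * n%:R)^-1 * j%:R.
Proof.
move=> /[dup] nnN /andP[nn _] km.
have t0 := tau_ge0 nnN km.
rewrite /test_fun subnS (tau_step n k); set l := (K.+1 - j)%N.
have [d0 d1] := andP (pois_cdf_drop l t0).
have st := pois_cdf_step l t0 (q_ge0 nn).
have pc := p_close k j nn.
set Q := pois_cdf _ l in d0 d1 st *; set Q' := pois_cdf _ l.-1 in d0 d1 st *.
have -> : (1 - p n k j) * Q + p n k j * Q' - pois_cdf (tau n k.+1 + q n) l =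
    (q n - p n k j) * (Q - Q') + (Q - q n * (Q - Q') - pois_cdf (tau n k.+1 + q n) l).
  by ring.
apply: (le_trans (ler_normD _ _)).
rewrite [leRHS]addrAC; apply: lerD st; apply: le_trans pc.
by rewrite normrM (ger0_norm d0) distrC ler_piMr.
Qed.

Let step_error n k : (n0 <= n < N)%N -> (k < m)%N ->
  `|E n k.+1 (test_fun n k.+1) - E n k (test_fun n k)| <=
  (C + 3) * (Num.sqrt n.+1%:R / ((n%:R - 1) * n%:R)).
Proof.
move=> /[dup] nnN /andP[nn _] km; have h := nR nn.
rewrite E_step// /E -sumrB; apply: le_trans (ler_norm_sum _ _ _) _.
under eq_bigr do rewrite -mulrBr normrM (ger0_norm (pmf_ge0 _ _ _)).
apply: (@le_trans _ _ (E n k (fun j => ((n%:R - 1)^-1 - q n + q n ^+ 2) +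
    ((n%:R - 1) * n%:R)^-1 * j%:R))).
  by apply: ler_sum => j _; rewrite ler_wpM2l// one_step_error.
rewrite E_affine//; last exact: ltnW.
have mb := mean_bound_step nn (ltnW km).
have d0 : 0 < (n%:R - 1) * n%:R :> R by apply: mulr_gt0; lra.
have t1 : 1 <= Num.sqrt n.+1%:R :> R by rewrite -[leLHS]sqrtr1 ler_wsqrtr// ler1n.
(* The constant 3: [1 / (n - 1) - 1 / (n + 1)] contributes 2 and [q n ^+ 2 <= 1 / n^2] contributes
   1, each over [(n - 1) n]. *)
have b1 : (n%:R - 1)^-1 - q n + q n ^+ 2 <= 3 / ((n%:R - 1) * n%:R).
  have /andP[q1 q2] := q_bounds nn.
  have q3 : q n ^+ 2 <= (n%:R ^+ 2)^-1 by rewrite -exprVn ler_pXn2r ?nnegrE ?q_ge0// invr_ge0; lra.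
  apply: (@le_trans _ _ ((n%:R - 1)^-1 - (n%:R + 1)^-1 + (n%:R ^+ 2)^-1)); first lra.
  have -> : (n%:R - 1)^-1 - (n%:R + 1)^-1 = 2 * ((n%:R - 1) * (n%:R + 1))^-1 :> R.
    by field; apply/andP; split; rewrite gt_eqF//; lra.
  have i1 : ((n%:R - 1) * (n%:R + 1))^-1 <= ((n%:R - 1) * n%:R)^-1 :> R.
    by rewrite lef_pV2 ?posrE//; nra.
  have i2 : (n%:R ^+ 2)^-1 <= ((n%:R - 1) * n%:R)^-1 :> R.
    by rewrite lef_pV2 ?posrE//; nra.
  lra.
rewrite [leRHS]mulrDl [leLHS]addrC; apply: lerD.
  by rewrite mulrA mulrC ler_wpM2r// invr_ge0 ltW.
apply: (le_trans b1); rewrite ler_wpM2l// ler_peMl// invr_ge0 ltW//.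
Qed.

Let steps_error n k : (n0 <= n < N)%N -> (k <= m)%N ->
  `|E n k (test_fun n k) - E n 0 (test_fun n 0)| <=
  k%:R * ((C + 3) * (Num.sqrt n.+1%:R / ((n%:R - 1) * n%:R))).
Proof.
move=> nnN; elim: k => [|k IH] km; first by rewrite subrr normr0 mul0r.
apply: (le_trans (ler_distD (E n k (test_fun n k)) _ _)).
by rewrite -[k.+1%:R]natr1 mulrDl mul1r addrC lerD// ?step_error// IH// ltnW.
Qed.

Let E_test_next n : (n0 <= n)%N ->
  E n.+1 0 (test_fun n.+1 0) = E n m (test_fun n m).
Proof. by move=> nn; rewrite E_next// /test_fun tau_next. Qed.

(** Makes the errors of order [n^(-3/2)] summable by telescoping, using
    [1 / s - 1 / t = 1 / (s t (s + t))]. For [n >= 2], [t <= 4 / 3 * s], and then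
    [7 / 3 * (n + 1) <= 12 (n - 1)] gives the constant 12. *)
Let telescope_bound n : (n0 <= n)%N ->
  Num.sqrt n.+1%:R / ((n%:R - 1) * n%:R) <=
  12 * ((Num.sqrt n%:R)^-1 - (Num.sqrt n.+1%:R)^-1) :> R.
Proof.
move=> nn; have h := nR nn; rewrite -[n.+1%:R]natr1.
have s2 : Num.sqrt n%:R ^+ 2 = n%:R :> R by rewrite sqr_sqrtr//; lra.
have t2 : Num.sqrt (n%:R + 1) ^+ 2 = n%:R + 1 :> R by rewrite sqr_sqrtr//; lra.
have s0 : 0 < Num.sqrt n%:R :> R by rewrite sqrtr_gt0; lra.
have t0 : 0 < Num.sqrt (n%:R + 1) :> R by rewrite sqrtr_gt0; lra.
move: s2 t2 s0 t0; set s := Num.sqrt _; set t := Num.sqrt _ => s2 t2 s0 t0.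
have -> : s^-1 - t^-1 = (s * t * (s + t))^-1.
  have d : (t - s) * (s + t) = 1 by rewrite [s + t]addrC -subr_sqr s2 t2; ring.
  apply: (mulIf (_ : s * t * (s + t) != 0)); first by rewrite !mulf_neq0 ?gt_eqF ?addr_gt0.
  rewrite mulVf ?mulf_neq0 ?gt_eqF ?addr_gt0// -[RHS]d; field.
  by rewrite !gt_eqF.
have t4s : t <= 4 / 3 * s.
  rewrite -(ler_pXn2r (_ : 0 < 2)%N) ?nnegrE ?ltW//; last by rewrite mulr_gt0.
  by rewrite exprMn t2 s2; lra.
rewrite ler_pdivrMr; last by apply: mulr_gt0; lra.
rewrite mulrAC ler_pdivlMr; last by rewrite !mulr_gt0// addr_gt0.
have -> : t * (s * t * (s + t)) = (n%:R + 1) * (s * (s + t)) by rewrite -t2; ring.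
have : s * (s + t) <= 7 / 3 * n%:R.
  by rewrite -s2; have := ltW s0; nra.
move=> H.
apply: (@le_trans _ _ ((n%:R + 1) * (7 / 3 * n%:R))).
  by rewrite ler_wpM2l//; lra.
nra.
Qed.

(** Each stage contributes [m] step errors, and [telescope_bound] sums the stages from [M] on. The
    bound does not depend on [N] or [K]. *)
Lemma chain_cdf_error M : (n0 <= M <= N)%N ->
  `|E N 0 (fun j => pois_cdf 0 (K.+1 - j)) -
    E M 0 (fun j => pois_cdf (m%:R * (ln N%:R - ln M%:R)) (K.+1 - j))| <=
  12 * m%:R * (C + 3) * (Num.sqrt M%:R)^-1.
Proof.
move=> /andP[nM MN].
pose kap : R := 12 * m%:R * (C + 3).
have E0 n : E n 0 (fun j => pois_cdf (m%:R * (ln N%:R - ln n%:R)) (K.+1 - j)) =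
    E n 0 (test_fun n 0).
  by congr (chain_mean _ _ _); apply/funext => j; rewrite /test_fun /tau mul0r subr0.
have := E0 N; rewrite subrr mulr0 => ->; rewrite E0 -/kap.
have kap0 : 0 <= kap by rewrite /kap !mulr_ge0// /C !addr_ge0// mulr_ge0.
suff H d : (M + d <= N)%N ->
    `|E (M + d)%N 0 (test_fun (M + d) 0) - E M 0 (test_fun M 0)| <=
    kap * ((Num.sqrt M%:R)^-1 - (Num.sqrt (M + d)%:R)^-1).
  have := H (N - M)%N; rewrite subnKC// => /(_ (leqnn _)) /le_trans; apply.
  by rewrite ler_wpM2l// gerBl invr_ge0 sqrtr_ge0.
elim: d => [|d IH] MdN.
  by rewrite addn0 !subrr normr0 mulr0.
have MdN' : (M + d < N)%N by rewrite -addnS.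
have nMd : (n0 <= M + d)%N by rewrite (leq_trans nM)// leq_addr.
rewrite addnS; apply: (le_trans (ler_distD (E (M + d)%N 0 (test_fun (M + d) 0)) _ _)).
have := IH (ltnW MdN'); have := @steps_error (M + d)%N m; rewrite nMd MdN' => /(_ isT (leqnn _)).
rewrite E_test_next//.
have := telescope_bound nMd.
have mC : 0 <= m%:R * (C + 3) by rewrite !mulr_ge0// /C !addr_ge0// mulr_ge0.
move=> /(ler_wpM2l mC) h1 h2 h3.
have -> : kap * ((Num.sqrt M%:R)^-1 - (Num.sqrt (M + d).+1%:R)^-1) =
  m%:R * (C + 3) * (12 * ((Num.sqrt (M + d)%:R)^-1 - (Num.sqrt (M + d).+1%:R)^-1)) +
  kap * ((Num.sqrt M%:R)^-1 - (Num.sqrt (M + d)%:R)^-1) by rewrite /kap; ring.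
by apply: lerD h3; apply: le_trans h1; rewrite -mulrA.
Qed.

End horizon.

(** With no Poisson time left the test function is the indicator of [j <= K]. *)
Let chain_mean_cdf N K : (n0 <= N)%N ->
  E N 0 (fun j => pois_cdf 0 (K.+1 - j)) = \sum_(j < K.+1) pmf N 0 j.
Proof.
move=> nN; rewrite -(@E_widen N 0 _ (maxn (B N) K.+1)) ?leq_maxl//.
rewrite [RHS](big_ord_widen (maxn (B N) K.+1) (pmf N 0)) ?leq_maxr//.
rewrite [RHS]big_mkcond/=; apply: eq_bigr => j _.
have [jK|Kj] := ltnP j K.+1; first by rewrite subSn// pois_cdf0 mulr1.
have -> : (K.+1 - j = 0)%N by apply/eqP; rewrite subn_eq0.
by rewrite /pois_cdf big_ord0 mulr0.
Qed.

(** First [M] is fixed so that the comparison error is at most [eps / 2], then [N] grows. The degree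
    at stage [M] is unknown but lies between 0 and [B M]. *)
Lemma chain_clt x :
  \sum_(j < (Num.truncn (m%:R * ln N%:R + x * Num.sqrt (m%:R * ln N%:R))).+1)
    pmf N 0 j @[N --> \oo] --> fine (normal_prob 0 1 [set` `]-oo, x]]).
Proof.
pose K (N : nat) := Num.truncn (m%:R * ln (N%:R : R) + x * Num.sqrt (m%:R * ln N%:R)).
set Phi := fine _.
pose kap : R := 12 * m%:R * (C + 3).
have kap0 : 0 <= kap by rewrite /kap !mulr_ge0// /C !addr_ge0// mulr_ge0.
apply/cvgrPdist_le => eps eps0.
have [M nM kM] : exists2 M, (n0 <= M)%N & kap * (Num.sqrt (M%:R : R))^-1 <= eps / 2.
  have h : kap * (Num.sqrt (M%:R : R))^-1 @[M --> \oo] --> (0 : R).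
    rewrite -(mulr0 kap); apply: cvgMr.
    apply/(gtr0_cvgV0 (f := fun M : nat => Num.sqrt (M%:R : R))).
      near=> M; rewrite sqrtr_gt0 ltr0n; near: M; exact: nbhs_infty_gt.
    by apply: cvgy_sqrt; exact: cvgr_idn.
  have e2 : 0 < eps / 2 by rewrite divr_gt0.
  near \oo => M; exists M; first by near: M; exact: nbhs_infty_ge.
  by near: M; exact: (cvgr_le _ h).
have cl (c : nat) : \forall N \near \oo,
    `|Phi - pois_cdf (m%:R * (ln N%:R - ln M%:R)) ((K N).+1 - c)| <= eps / 2.
  have e2 : 0 < eps / 2 by rewrite divr_gt0.
  by have /cvgrPdist_le/(_ _ e2) := @cvg_pois_threshold R m M c x m_gt0.
near=> N.
have nMN : (M <= N)%N by near: N; exact: nbhs_infty_ge.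
have M0 : (0 < M)%N by apply: leq_trans nM; exact: ltnW.
rewrite -chain_mean_cdf; last exact: leq_trans nMN.
rewrite -/(K N).
have := @chain_cdf_error N (K N) M; rewrite nM nMN => /(_ isT).
rewrite -/kap.
pose t : R := m%:R * (ln N%:R - ln M%:R).
have t0 : 0 <= t.
  by rewrite /t mulr_ge0// subr_ge0 ler_ln ?posrE ?ltr0n ?ler_nat// (leq_trans M0).
(* Monotonicity in the threshold squeezes the mean between the two extreme shifts, which have the
   same normal limit. *)
have EM : pois_cdf t ((K N).+1 - B M) <=
    E M 0 (fun j => pois_cdf t ((K N).+1 - j)) <= pois_cdf t ((K N).+1 - 0).
  have cstE (a : R) : a = \sum_(j < B M) pmf M 0 j * a.
    by rewrite -mulr_suml pmf_sum// mul1r.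
  rewrite [X in X <= _ <= _]cstE [X in _ <= _ <= X]cstE; apply/andP; split.
    by apply: ler_sum => j _; rewrite ler_wpM2l// pois_cdf_homo// leq_sub2l// ltnW.
  by apply: ler_sum => j _; rewrite ler_wpM2l// pois_cdf_homo// leq_sub2l.
have h0 : `|Phi - pois_cdf t ((K N).+1 - 0)| <= eps / 2.
  by rewrite /t; near: N; exact: cl.
have hB : `|Phi - pois_cdf t ((K N).+1 - B M)| <= eps / 2.
  by rewrite /t; near: N; exact: cl.
move: EM h0 hB; rewrite -/t.
set a := E N 0 _; set b := E M 0 _; set lo := pois_cdf t _; set hi := pois_cdf t _.
move=> /andP[lob bhi]; rewrite !ler_norml => /andP[h1 h2] /andP[h3 h4] ab.
move: ab kM => /andP[]; set z := kap / _ => h5 h6 h7.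
by rewrite -/a; apply/andP; split; lra.
Unshelve. all: end_near. Qed.

End depref_chain.

(** * The degree of a vertex as a Markov chain *)

Lemma degree_add_vertex (m : nat) (g : multigraph) (j : nat) :
  degree (add_vertex m g) j = (m * ((nvertices g).+1 == j) + degree g j)%N.
Proof.
by rewrite /degree /= count_cat count_nseq addnCA mulnC.
Qed.

Lemma degree_attach (g : multigraph) (i j : nat) : i != nvertices g ->
  degree (attach g j) i = (degree g i + (j == i))%N.
Proof.
move=> ig; rewrite /degree /= -cats1 big_cat big_seq1/=.
by rewrite count_rem /= [nvertices g == i]eq_sym (negbTE ig) andbF subn0 addn0 addnAC.
Qed.

(** The 2 allows for both ends of the new edge being [i], so no relation between [i] and the newest
    vertex is assumed. *)
Lemma degree_attach_le (g : multigraph) (i j : nat) :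
  (degree (attach g j) i <= degree g i + 2)%N.
Proof.
rewrite /degree /= -cats1 big_cat big_seq1/= addnAC leq_add//.
  by rewrite leq_add2l count_rem leq_subr.
exact: leq_add (leq_b1 _) (leq_b1 _).
Qed.

Lemma degree_initial_graph_le (m s i : nat) :
  (degree (initial_graph m s) i <= 3 * m)%N.
Proof.
rewrite /degree /= count_nseq.
have -> : (3 * m = 2 * m + m)%N by rewrite mulSn addnC.
apply: leq_add; last by rewrite -[leqRHS]mul1n leq_mul2r leq_b1 orbT.
apply: (@leq_trans (\sum_(e <- nseq m (1, 2)%N) 2)).
  by apply: leq_sum => e _; rewrite (leq_add (leq_b1 _) (leq_b1 _)).
by rewrite big_const_seq count_nseq/= mul1n iter_addn_0 mulnC.
Qed.

Section run.
Context (d : measure_display) (T : measurableType d) (R : realType).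
Context (P : probability T R) (m : nat) (m_gt0 : (0 < m)%N).
Context (G : nat -> T -> multigraph) (H : nat -> nat -> T -> multigraph).
Context (e : nat -> nat -> T -> nat) (rn : depref_attachment_run P m G H e).

Let nvertices_H_of_G n w : (2 <= n)%N -> nvertices (G n w) = n ->
  forall k, (k <= m)%N -> nvertices (H n.+1 k w) = n.+1.
Proof.
move=> n2 Gn; elim=> [|k IH] km; first by rewrite (run_new_vertex rn)//= Gn.
by rewrite (run_attach rn)//= IH// ltnW.
Qed.

Let nvertices_G n w : (2 <= n)%N -> nvertices (G n w) = n.
Proof.
move=> /subnK <-; elim: (n - 2)%N => [|k IH].
  by have [->|->] := run_init rn w.
by rewrite addSn (run_complete rn) ?leq_addl// nvertices_H_of_G ?leq_addl.
Qed.

Let nvertices_H n k w : (2 <= n)%N -> (k <= m)%N -> nvertices (H n.+1 k w) = n.+1.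
Proof. by move=> n2 km; apply: nvertices_H_of_G => //; exact: nvertices_G. Qed.

Let degree_H_le n k w i : (2 <= n)%N -> (k <= m)%N ->
  (degree (H n.+1 k w) i <= degree (G n w) i + m + 2 * k)%N.
Proof.
move=> n2; elim: k => [|k IH] km.
  rewrite (run_new_vertex rn)// degree_add_vertex muln0 addn0 addnC leq_add2l.
  by rewrite -[leqRHS]muln1 leq_mul2l leq_b1 orbT.
rewrite (run_attach rn)//; apply: leq_trans (degree_attach_le _ _ _) _.
by rewrite mulnS addnCA addnC leq_add2l IH// ltnW.
Qed.

(** Each stage adds at most [m] half-edges and [2 * m] edge ends. This crude bound serves to make
    the support finite. *)
Let degree_G_le n w i : (2 <= n)%N -> (degree (G n w) i <= 3 * m * n)%N.
Proof.
move=> /subnK <-; elim: (n - 2)%N => [|k IH].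
  apply: (@leq_trans (3 * m)%N); last by rewrite leq_pmulr.
  by have [->|->] := run_init rn w; exact: degree_initial_graph_le.
rewrite addSn (run_complete rn) ?leq_addl//.
apply: leq_trans (degree_H_le _ _ _ _) _ => //; first exact: leq_addl.
by rewrite -addnA mulnS [leqRHS]addnC leq_add// mulSn.
Qed.

Variables (i : nat) (i_gt0 : (0 < i)%N).
(** From this stage on [v_i] exists and is never the newest vertex, so its degree changes only when
    it is chosen as a target. *)
Let n0 := maxn i 2.
Let D n k w := degree (H n.+1 k w) i.

Let n0_le n : (n0 <= n)%N -> (2 <= n)%N && (i <= n)%N.
Proof. by rewrite geq_max andbC. Qed.

Let D0 n w : (n0 <= n)%N -> D n 0 w = degree (G n w) i.
Proof.
move=> /n0_le/andP[n2 ni]; rewrite /D (run_new_vertex rn)// degree_add_vertex nvertices_G//.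
by rewrite gtn_eqF ?muln0.
Qed.

Let D_step n k w : (n0 <= n)%N -> (k < m)%N ->
  D n k.+1 w = (D n k w + (e n.+1 k.+1 w == i))%N.
Proof.
move=> /n0_le/andP[n2 ni] km; rewrite /D (run_attach rn)// degree_attach//.
by rewrite nvertices_H ?(ltnW km)// ltn_eqF.
Qed.

Let D_next n w : (n0 <= n)%N -> D n.+1 0 w = D n m w.
Proof.
move=> nn; rewrite D0 ?leqW// (run_complete rn)//.
by have /andP[] := n0_le nn.
Qed.

Let B n := (3 * m * n.+1).+1.

Let D_lt n k w : (n0 <= n)%N -> (k <= m)%N -> (D n k w < B n)%N.
Proof.
move=> /n0_le/andP[n2 _] km; rewrite ltnS.
apply: leq_trans (degree_H_le _ _ n2 km) _.
rewrite mulnS [leqRHS]addnC -addnA leq_add ?degree_G_le// (mulSn 2 m) leq_add2l.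
by rewrite leq_mul2l km orbT.
Qed.

Let filtration_measurable n k A : (2 <= n)%N -> (k <= m)%N ->
  natural_filtration m (G 2) e n.+1 k A -> measurable A.
Proof.
move=> n2 km; apply: smallest_sub; first exact: sigma_algebra_measurable.
move=> _ [[g ->]|[l [r [j [lr ->]]]]]; first exact: (run_measurable_init rn).
have [l' [r' [-> -> l2 rm]]] : exists l' r', [/\ l = l'.+1, r = r'.+1, (2 <= l')%N & (r' < m)%N].
  case: l lr => [|l']; first by case=> [[]//|[]].
  case: r => [|r']; first by case=> [[_ []]//|[]].
  case=> [[/andP[l2 _] r1]|[[->] r1]]; [exists l'|exists n]; exists r'; split => //.
  by case/andP: r1 => _ r1; exact: leq_trans km.
exact: (run_measurable_target rn).
Qed.

Let prob n k w : R := depref_prob m n k (D n k w).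

Let cond_prob n k : (n0 <= n)%N -> (k < m)%N ->
  is_cond_prob P (natural_filtration m (G 2) e n.+1 k)
    [set w | e n.+1 k.+1 w = i] (prob n k).
Proof.
by move=> /n0_le/andP[n2 ni] km; apply: (run_cond_prob rn) => //; rewrite i_gt0.
Qed.

(* The conditional probability is an injective function of the degree, so its
   adaptedness makes the degree adapted. *)
Let filtration_D n k j : (n0 <= n)%N -> (k < m)%N ->
  natural_filtration m (G 2) e n.+1 k [set w | D n k w = j].
Proof.
move=> nn km; have /andP[n2 _] := n0_le nn.
have [+ _] := cond_prob nn km.
move=> /(_ _ (measurable_set1 (depref_prob m n k j))).
have n1R : 2 <= n%:R :> R by rewrite ler_nat.
have m0R : 0 < m%:R :> R by rewrite ltr0n.
have k0R : 0 <= k%:R :> R by [].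
rewrite (_ : prob n k @^-1` _ = [set w | D n k w = j])//.
apply/seteqP; split => w /=; last by move=> Dj; rewrite /prob Dj.
rewrite /prob /depref_prob => /mulfI.
rewrite div1r invr_eq0 subr_eq0 gt_eqF; last by lra.
move=> /(_ isT) /addrI /oppr_inj /mulIf.
rewrite invr_eq0 gt_eqF; last by rewrite ltr_wpDl// mulr_gt0//; lra.
by move=> /(_ isT) /eqP; rewrite eqr_nat => /eqP.
Qed.

Let measurable_D n k j : (n0 <= n)%N -> (k <= m)%N ->
  measurable [set w | D n k w = j].
Proof.
move=> nn; rewrite leq_eqVlt => /predU1P[->|km]; last first.
  have /andP[n2 _] := n0_le nn.
  exact: (filtration_measurable n2 (ltnW km) (filtration_D _ nn km)).
(* [filtration_D] covers [k < m] only; the state after the last half-edge is the initial state of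
   the next stage. *)
rewrite (_ : [set w | _] = [set w | D n.+1 0 w = j]); last first.
  by apply/funext => w; rewrite /= D_next.
have /andP[n2 _] := n0_le nn.
by apply: (filtration_measurable _ _ (filtration_D _ _ _)); rewrite ?leqW.
Qed.

Let measurable_e n k : (n0 <= n)%N -> (k < m)%N ->
  measurable [set w | e n.+1 k.+1 w = i].
Proof. by move=> /n0_le/andP[n2 _] km; exact: (run_measurable_target rn). Qed.

Definition degree_pmf n k j : R := fine (P [set w | D n k w = j]).
Notation pmf := degree_pmf.

Let fine_PK A : measurable A -> (fine (P A))%:E = P A.
Proof. by move=> mA; rewrite fineK// fin_num_measure. Qed.

(** On the event that the degree is [j] the conditional probability is constant, so its integral is
    a product. This reduces the full history to a Markov chain. *)
Let joint n k j : (n0 <= n)%N -> (k < m)%N ->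
  P ([set w | D n k w = j] `&` [set w | e n.+1 k.+1 w = i]) =
  (depref_prob m n k j * pmf n k j)%:E.
Proof.
move=> nn km; have [_ /(_ _ (filtration_D j nn km)) ->] := cond_prob nn km.
rewrite (eq_integral (fun=> (depref_prob m n k j)%:E)); last first.
  by move=> w; rewrite inE/= /prob => ->.
have mD := measurable_D j nn (ltnW km).
rewrite integral_cst//; move: (depref_prob m n k j) => p.
by rewrite EFinM /degree_pmf fine_PK.
Qed.

Let joint_not n k j : (n0 <= n)%N -> (k < m)%N ->
  P ([set w | D n k w = j] `\` [set w | e n.+1 k.+1 w = i]) =
  (pmf n k j * (1 - depref_prob m n k j))%:E.
Proof.
move=> nn km; have mD := measurable_D j nn (ltnW km).
rewrite measureD ?joint//=; [|exact: measurable_e|by rewrite -ge0_fin_numE// fin_num_measure].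
have -> : P [set w | D n k w = j] = (pmf n k j)%:E by rewrite /degree_pmf fine_PK.
by rewrite joint// -EFinB; congr EFin; rewrite mulrBr mulr1 mulrC.
Qed.

Let pmf_step0 n k : (n0 <= n)%N -> (k < m)%N ->
  pmf n k.+1 0 = pmf n k 0 * (1 - depref_prob m n k 0).
Proof.
move=> nn km; rewrite {1}/degree_pmf -[RHS]/(fine (_)%:E) -joint_not//.
congr (fine (P _)); apply/seteqP; split => w /=; rewrite D_step//.
  by case: (e n.+1 k.+1 w =P i) => [_|ne]; rewrite ?addn1// addn0.
by move=> [-> /eqP/negbTE ->].
Qed.

Let pmf_stepS n k j : (n0 <= n)%N -> (k < m)%N ->
  pmf n k.+1 j.+1 = pmf n k j.+1 * (1 - depref_prob m n k j.+1) +
    pmf n k j * depref_prob m n k j.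
Proof.
move=> nn km; rewrite {1}/degree_pmf [X in _ + X]mulrC.
rewrite -[RHS]/(fine (_%:E + _%:E)%E) -joint_not// -joint//.
have mD j' := measurable_D j' nn (ltnW km); have me := measurable_e nn km.
rewrite -measureU//; [|exact: measurableD|exact: measurableI|]; last first.
  by apply/seteqP; split => w //= [[_ ne] [_ /ne]].
congr (fine (P _)); apply/seteqP; split => w /=; rewrite D_step//.
  case: (e n.+1 k.+1 w =P i) => [ei|ne]; first by rewrite addn1 => -[Dj]; right.
  by rewrite addn0 => Dj; left.
by case=> [[-> /eqP/negbTE ->]|[-> ->]]; rewrite ?addn0// eqxx addn1.
Qed.

Let pmf_next n j : (n0 <= n)%N -> pmf n.+1 0 j = pmf n m j.
Proof.
by move=> nn; rewrite /degree_pmf; congr (fine (P _)); apply/funext => w /=; rewrite D_next.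
Qed.

Let pmf_ge0 n k j : 0 <= pmf n k j.
Proof. exact: fine_ge0. Qed.

Let D_ltE n k L : [set w | (D n k w < L)%N] =
  \bigcup_(j < L) [set w | D n k w = j].
Proof.
apply/seteqP; split => w /=; first by move=> DL; exists (D n k w).
by move=> [j /= jL ->].
Qed.

Let measurable_D_lt n k L : (n0 <= n)%N -> (k <= m)%N ->
  measurable [set w | (D n k w < L)%N].
Proof.
move=> nn km; rewrite D_ltE.
by apply: bigcup_measurable => j _; exact: measurable_D.
Qed.

Let degree_leE n L : (n0 <= n)%N ->
  [set w | (D n 0 w < L.+1)%N] = [set w | (degree (G n w) i <= L)%N].
Proof. by move=> nn; apply/funext => w /=; rewrite D0. Qed.

Let sum_pmf n k L : (n0 <= n)%N -> (k <= m)%N ->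
  (\sum_(j < L) pmf n k j)%:E = P [set w | (D n k w < L)%N].
Proof.
move=> nn km; rewrite -sumEFin.
rewrite (eq_bigr (fun j : 'I_L => P [set w | D n k w = j])); last first.
  by move=> j _; rewrite /degree_pmf fine_PK//; exact: measurable_D.
rewrite -(@measure_bigsetU _ _ _ P (fun j => [set w | D n k w = j])).
- by rewrite D_ltE (bigcup_mkord L (fun j => [set w | D n k w = j])).
- by move=> j; exact: measurable_D.
- by apply/trivIsetP => a b _ _ ab; apply/seteqP; split => w //= [-> /eqP]; rewrite (negbTE ab).
Qed.

Let pmf_sum n k : (n0 <= n)%N -> (k <= m)%N -> \sum_(j < B n) pmf n k j = 1.
Proof.
move=> nn km; apply: EFin_inj; rewrite sum_pmf// -(@probability_setT _ _ _ P).
by congr (P _); apply/seteqP; split => w //= _; exact: D_lt.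
Qed.

Let pmf_supp n k j : (n0 <= n)%N -> (k <= m)%N -> (B n <= j)%N -> pmf n k j = 0.
Proof.
move=> nn km Bj; rewrite /degree_pmf (_ : [set w | _] = set0) ?measure0//.
apply/seteqP; split => w //= Dj; have := D_lt w nn km.
by rewrite Dj ltnNge Bj.
Qed.

Lemma cvg_degree_cdf x :
  P [set w | (degree (G n w) i <=
    Num.truncn (m%:R * ln n%:R + x * Num.sqrt (m%:R * ln n%:R)))%N] @[n --> \oo] -->
  normal_prob 0 1 [set` `]-oo, x]].
Proof.
rewrite -[X in _ --> X]fineK ?fin_num_measure//.
have n0_ge2 : (2 <= n0)%N by exact: leq_maxr.
have /(_ x) h := chain_clt m_gt0 n0_ge2 pmf_ge0 pmf_supp pmf_sum pmf_step0 pmf_stepS pmf_next.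
apply: cvg_EFin.
  near=> n; have nn : (n0 <= n)%N by near: n; exact: nbhs_infty_ge.
  by rewrite fin_num_measure// -(degree_leE _ nn); exact: measurable_D_lt.
apply: cvg_trans h; apply: near_eq_cvg; near=> n => /=.
have nn : (n0 <= n)%N by near: n; exact: nbhs_infty_ge.
apply: EFin_inj; rewrite sum_pmf// fine_PK; rewrite -(degree_leE _ nn)//.
exact: measurable_D_lt.
Unshelve. all: end_near. Qed.

Lemma measurable_degree n : (maxn i 2 <= n)%N ->
  measurable_fun [set: T] (fun w => (degree (G n w) i)%:R : R).
Proof.
move=> nn _ Y mY; rewrite setTI.
rewrite (_ : _ @^-1` Y = \bigcup_(j in [set j | Y j%:R]) [set w | D n 0 w = j]).
  by apply: bigcup_measurable => j _; exact: measurable_D.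
apply/seteqP; split => w /=; first by move=> Yw; exists (D n 0 w) => //=; rewrite D0.
by move=> [j Yj] Dj; rewrite -D0// Dj.
Qed.

End run.

Theorem theorem2p6 (d : measure_display) (T : measurableType d) (R : realType)
    (P : probability T R) (m : nat) (hm : (1 < m)%N)
    (G : nat -> T -> multigraph) (hG : linear_depref_attachment P m G)
    (i : nat) (hi : (1 <= i)%N) :
  cvg_in_distribution P
    (fun (n : nat) (w : T) =>
       ((degree (G n w) i)%:R - m%:R * ln n%:R) / Num.sqrt (m%:R * ln n%:R))
    (normal_prob 0 1).
Proof.
have m0 : (0 < m)%N by exact: ltnW.
have [H [e rn]] := hG; split.
  near=> n; apply: measurable_funM => //; apply: measurable_funB => //.
  by apply: (measurable_degree m0 rn hi); near: n; exact: nbhs_infty_ge.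
move=> x _; apply: cvg_trans (@cvg_degree_cdf _ _ _ P m m0 G H e rn i hi x).
apply: near_eq_cvg; near=> n; congr (P _); apply/funext => w /=; apply/propext.
(* For large [n] the scale is positive and the threshold nonnegative, so the normalised inequality
   says that the degree is at most the truncated threshold. *)
have /andP[r0 rv] : 0 < Num.sqrt (m%:R * ln (n%:R : R)) <=
    m%:R * ln n%:R + x * Num.sqrt (m%:R * ln n%:R).
  by near: n; exact: near_threshold_ge.
by rewrite ler_pdivrMr// lerBlDl truncn_ge_nat// (le_trans (ltW r0)).
Unshelve. all: end_near. Qed.
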